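(* For a pregeometry $G$ and a finite subpregeometry $H\subseteq G$, the following are equivalent: (1) $H\sqsubseteq G$; (2) $H\sqsubseteq^* G$ and $H\leqslant_r G$; (3) there exist good representations $\mathcal{A}$ and $\mathcal{B}$ of $G$ and $H$, respectively, such that $\mathcal{B}\leqslant\mathcal{A}$.
   Context: Pregeometries. A pregeometry $G$ on a (possibly infinite) set $M$ is a function $d=d_G$ from the finite subsets of $M$ to $\mathbb{N}$ such that $d(\emptyset)=0$, $d(A)\le d(A\cup\{x\})\le d(A)+1$, and $d(A\cup B)+d(A\cap B)\le d(A)+d(B)$. A finite $A$ is independent if $d(A)=|A|$; an arbitrary set is independent if all its finite subsets are; $d(Y)=\sup\{|Y_0|: Y_0\subseteq Y \text{ independent}\}$ for arbitrary $Y$. For finite $A$, $\mathrm{cl}_G(A)=\{x: d(A\cup\{x\})=d(A)\}$, and $\mathrm{cl}_G(Y)=\bigcup\{\mathrm{cl}_G(Y_0): Y_0\subseteq Y\text{ finite}\}$. $Y$ is closed in $G$ if $\mathrm{cl}_G(Y)=Y$. A subpregeometry $H\subseteq G$ is the restriction of $d_G$ to subsets of a subset of $M$; subsets and subpregeometries are identified. Alternating sums. For a finite collection $\Sigma=\{E_1,\dots,E_k\}$ of finite-dimensional closed sets of $G$ let $\Delta_G(\Sigma)=\sum_{\emptyset\ne s\subseteq\{1,\dots,k\}}(-1)^{|s|+1}d_G\left(\bigcap_{i\in s}E_i\right)$. Embeddings. For $H\subseteq G$: $H\sqsubseteq^* G$ means that $d_H(X_1\cap X_2)=d_G(\mathrm{cl}_G(X_1)\cap\mathrm{cl}_G(X_2))$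 for all $X_1,X_2\subseteq H$ closed in $H$. $H\sqsubseteq G$ means that for every finite collection $\Sigma$ of finite-dimensional closed sets of $G$, $\Delta_H(\{E\cap H: E\in\Sigma\})\le\Delta_G(\Sigma)$. Prerank. For a pregeometry $G$ and finite $X\subseteq G$ define recursively $\alpha_G(X)=|X|-d_G(X)-\sum_{Y}\alpha_G(Y)$, the sum over all $Y\subsetneq X$ that are closed in $G$ (an empty sum is $0$). Let $\mathfrak{O}$ be the free $\mathbb{Z}$-module generated by the symbols $\omega^i$, $i<\omega+1$ (i.e. $i\in\mathbb{N}$ or $i=\omega$), ordered by: $\sum a_i\omega^i<\sum b_i\omega^i$ iff $a_j<b_j$ where $j=\max\{i: a_i\ne b_i\}$. For a finite pregeometry $G$ let $\rho(G)=d_G(G)\,\omega^\omega+\sum_{X\text{ closed in }G}\alpha_G(X)\,\omega^{d_G(X)}\in\mathfrak{O}$. For $H\sqsubseteq^* G$ with $H$ finite, $H\leqslant_r G$ means $\rho(H')\ge\rho(H)$ for every finite $H'$ with $H\subseteq H'\sqsubseteq^* G$. Hypergraphs. A hypergraph $\mathcal{A}=(M,R)$ is a set $M$ with a set $R$ of non-empty finite subsets of $M$ (edges). For $P\subseteq M$, $R[P]=\{e\in R: e\subseteq P\}$. For finite $Y\subseteq M$, $\delta_{\mathcal{A}}(Y)=|Y|-|R[Y]|$. For finite $X\subseteq M$, $d_{\mathcal{A}}(X)=\inf\{\delta_{\mathcal{A}}(Y): X\subseteq Y\subseteq M,\ Y\text{ finite}\}$. If $d_{\mathcal{A}}$ is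 non-negative, it is the dimension function of a pregeometry $G_{\mathcal{A}}$ on $M$. $\mathcal{A}$ is a representation of $G$ if $G_{\mathcal{A}}=G$; it is good if moreover $d_{\mathcal{A}}(e)=|e|-1$ for every $e\in R$. For $P\subseteq M$ and finite $X\subseteq M$ let $\delta_{\mathcal{A}}(X/P)=|X\setminus P|-|R[X\cup P]\setminus R[P]|$. For $\mathcal{B}=(P,R[P])$ with $P\subseteq M$, $\mathcal{B}\leqslant\mathcal{A}$ means $\delta_{\mathcal{A}}(X/P)\ge 0$ for every finite $X\subseteq M$.
   Formalization: The pregeometry G is assumed to have some representation by a hypergraph (not necessarily good); without this the equivalence fails, e.g. for H = G the cycle matroid of K_4, where (1) and (2) hold but (3) does not. *)

(* Defs.v *)
(* MathComp with the classical sets and finite sets of MathComp-Analysis and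
   finmap. *)
From HB Require Import structures.
From mathcomp Require Import all_boot all_order all_algebra.
From mathcomp Require Import finmap.
From mathcomp Require Import boolp classical_sets cardinality.
From mathcomp Require monalg.
Import monalg.

Set Implicit Arguments.
Unset Strict Implicit.
Unset Printing Implicit Defensive.

Import Order.TTheory GRing.Theory Num.Theory.

Local Open Scope classical_set_scope.
Local Open Scope ring_scope.

(* A pregeometry on the set [ground], a subset of an ambient type [M] (take
   [ground = setT] for a pregeometry on all of [M]).  The values of [gdim] on
   finite sets that are not included in [ground] are irrelevant: nothing below
   depends on them. *)
Record pregeometry (M : choiceType) := Pregeometry {
  ground : set M;
  gdim : {fset M} -> nat;
  gdim0 : gdim fset0 = 0%N;
  gdim_step : forall (A : {fset M}) (x : M),
    [set` A] `<=` ground -> ground x ->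
    (gdim A <= gdim (x |` A)%fset <= (gdim A).+1)%N;
  gdim_submod : forall A B : {fset M},
    [set` A] `<=` ground -> [set` B] `<=` ground ->
    (gdim (A `|` B)%fset + gdim (A `&` B)%fset <= gdim A + gdim B)%N
}.

Section Pregeometries.
Variable M : choiceType.
Implicit Types (G H : pregeometry M) (Y P : set M) (X A : {fset M}).

Definition subpregeometry H G : Prop :=
  ground H `<=` ground G /\
  forall A, [set` A] `<=` ground H -> gdim H A = gdim G A.

Definition independent G A : Prop := gdim G A = #|` A|%N.

(* [is_dim G Y n]: the supremum of the sizes of the independent subsets of [Y]
   is the natural number [n].  Finite independent sets suffice: an infinite
   independent set has finite independent subsets of every size. *)
Definition is_dim G Y (n : nat) : Prop :=
  (exists A, [/\ [set` A] `<=` Y, independent G A & #|` A|%N = n]) /\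
  (forall A, [set` A] `<=` Y -> independent G A -> (#|` A| <= n)%N).

Definition finite_dim G Y : Prop := exists n, is_dim G Y n.

(* Meaningful only when [finite_dim G Y]. *)
Definition dim G Y : nat := xget 0%N [set n | is_dim G Y n].

Definition cl G Y : set M :=
  [set x | ground G x /\
     exists A, [set` A] `<=` Y /\ gdim G (x |` A)%fset = gdim G A].

Definition closed G Y : Prop := Y `<=` ground G /\ cl G Y = Y.

(* A finite collection is given by an enumeration, possibly with repetitions;
   repeating a set does not change the alternating sum. *)
Definition Delta G (k : nat) (E : 'I_k -> set M) : int :=
  \sum_(s : {set 'I_k} | s != finset.set0)
     (-1) ^+ #|s|.+1 * (dim G [set x | forall i, i \in s -> E i x])%:Z.

(* The notion written as a square inclusion with a star.  Comparing [is_dim]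
   rather than [dim] makes the equality of dimensions correct also when one
   of them is infinite. *)
Definition sqsub_star H G : Prop :=
  forall X1 X2 : set M, closed H X1 -> closed H X2 ->
  forall n, is_dim H (X1 `&` X2) n <-> is_dim G (cl G X1 `&` cl G X2) n.

Definition sqsub H G : Prop :=
  forall (k : nat) (E : 'I_k -> set M),
    (forall i, closed G (E i) /\ finite_dim G (E i)) ->
    Delta H (fun i => E i `&` ground H) <= Delta G E.

(* [n] bounds the depth of the recursion; [alpha_rec #|` X|] never exhausts it,
   see [alphaE]. *)
Fixpoint alpha_rec G (n : nat) X : int :=
  if n is m.+1 then
    (#|` X|%N)%:Z - (gdim G X)%:Z
    - \sum_(Y <- fpowerset X | (Y `<` X)%fset && `[< closed G [set` Y] >])
         alpha_rec G m Y
  else 0.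

Definition alpha G X : int := alpha_rec G #|` X| X.

Lemma alpha_rec_stable G n X :
  (#|` X| <= n)%N -> alpha_rec G n X = alpha G X.
Proof.
rewrite /alpha; elim: n {-2}n (leqnn n) X => [|N IH] n leN X.
  by move: leN; rewrite leqn0 => /eqP ->; rewrite leqn0 => /eqP ->.
case: n leN => [_|n leN]; first by rewrite leqn0 => /eqP ->.
move=> leX; case E: #|` X| leX => [|c] leX /=.
  move/cardfs0_eq: E => ->; rewrite cardfs0 gdim0 subr0 sub0r.
  by rewrite big1 ?oppr0 // => Y /andP[]; rewrite fproperE fsubset0 => /andP[/eqP-> ]; rewrite fsub0set.
congr (_ - _); apply: eq_bigr => Y /andP[/fproper_ltn_card]; rewrite E ltnS => leY _.
rewrite (IH n) ?(IH c) //; try exact: leq_trans leY _.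
exact: leq_trans leX leN.
Qed.

Lemma alphaE G X :
  alpha G X = (#|` X|%N)%:Z - (gdim G X)%:Z
    - \sum_(Y <- fpowerset X | (Y `<` X)%fset && `[< closed G [set` Y] >])
         alpha G Y.
Proof.
rewrite -(@alpha_rec_stable _ #|` X|.+1) //=; congr (_ - _).
by apply: eq_bigr => Y /andP[/fproper_ltn_card/ltnW leY _]; rewrite alpha_rec_stable.
Qed.

End Pregeometries.

(* The free Z-module on the symbols omega^i for i in nat or i = omega; the
   index omega is [None]. *)
Definition omod := {malg int[option nat]}.

Definition idx_lt (i j : option nat) : bool :=
  match i, j with
  | Some m, Some n => (m < n)%N
  | Some _, None => true
  | None, _ => false
  end.

Definition omod_lt (a b : omod) : Prop :=
  exists j, a@_j < b@_j /\ forall i, idx_lt j i -> a@_i = b@_i.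

Definition omod_le (a b : omod) : Prop := a = b \/ omod_lt a b.

Section Rank.
Variable M : choiceType.
Implicit Types G H : pregeometry M.

(* Meaningful only for a finite pregeometry: [fset_set] of an infinite set is
   empty. *)
Definition rho G : omod :=
  let V := fset_set (ground G) in
  << (gdim G V)%:Z *g None >>
  + \sum_(X <- fpowerset V | `[< closed G [set` X] >])
       << alpha G X *g Some (gdim G X) >>.

Definition rank_le H G : Prop :=
  forall H' : pregeometry M, finite_set (ground H') ->
    subpregeometry H H' -> subpregeometry H' G -> sqsub_star H' G ->
    omod_le (rho H) (rho H').

End Rank.

Record hypergraph (M : choiceType) := Hypergraph {
  vert : set M;
  edge : set {fset M};
  edge_neq0 : forall e, edge e -> e != fset0;
  edge_vert : forall e, edge e -> [set` e] `<=` vert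
}.

Section Hypergraphs.
Variable M : choiceType.
Implicit Types (A B : hypergraph M) (G : pregeometry M).
Implicit Types (X Y e : {fset M}) (P : set M).

Definition edges_in A P : set {fset M} :=
  [set e | edge A e /\ [set` e] `<=` P].

Definition delta A Y : int :=
  (#|` Y|%N)%:Z - (#|` fset_set (edges_in A [set` Y])|%N)%:Z.

(* [is_hdim A X n]: the infimum of [delta A Y] over the finite sets [Y] of
   vertices including [X] is the integer [n] (and not minus infinity). *)
Definition is_hdim A X (n : int) : Prop :=
  (exists Y, [/\ (X `<=` Y)%fset, [set` Y] `<=` vert A & delta A Y = n]) /\
  (forall Y, (X `<=` Y)%fset -> [set` Y] `<=` vert A -> n <= delta A Y).

Definition representation A G : Prop :=
  vert A = ground G /\
  forall X, [set` X] `<=` vert A -> is_hdim A X (gdim G X)%:Z.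

(* The pregeometries under consideration are those that come from hypergraphs.
   Others exist: the cycle matroid of the complete graph on four vertices has
   no representation, although it is embedded in itself in every sense. *)
Definition representable G : Prop := exists A, representation A G.

Definition good_representation A G : Prop :=
  representation A G /\
  forall e, edge A e -> is_hdim A e ((#|` e|%N)%:Z - 1).

Definition new_edges A X P : set {fset M} :=
  edges_in A ([set` X] `|` P) `\` edges_in A P.

(* Meaningful only if [new_edges A X P] is finite, as is the case for finite
   [P]; the relative predimension is minus infinity otherwise. *)
Definition delta_rel A X P : int :=
  (#|` fset_set ([set` X] `\` P)|%N)%:Z
  - (#|` fset_set (new_edges A X P)|%N)%:Z.

Definition hyper_le B A : Prop :=
  [/\ vert B `<=` vert A,
      edge B = edges_in A (vert B) &
      forall X, [set` X] `<=` vert A ->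
        finite_set (new_edges A X (vert B)) /\ 0 <= delta_rel A X (vert B)].

End Hypergraphs.

(* Main.v *)
Require Import Defs.
From mathcomp Require Import all_boot all_order all_algebra finmap.
From mathcomp Require Import boolp classical_sets cardinality.
From mathcomp Require Import zify.
From mathcomp Require monalg.
Import monalg Defs.

Set Implicit Arguments.
Unset Strict Implicit.
Unset Printing Implicit Defensive.

Import Order.TTheory GRing.Theory Num.Theory.

Local Open Scope classical_set_scope.
Local Open Scope nat_scope.

(** Fix a representation of [G].  The predimension of a finite set is its
    number of points minus the number of edges within it, and its dimension is
    the least predimension of a finite superset.  A finite set [P] is
    self-sufficient ([tight]) when its predimension is its dimension.  All three
    conditions of the theorem say that [G] has some representation in which [H]
    is self-sufficient: then the edges within [H] represent [H], and being
    self-sufficient is the same as the relation between hypergraphs.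

    From hypergraphs to alternating sums ([tight_sqsub]).  Self-sufficient sets
    meet closed sets in self-sufficient sets.  So, inside a large self-sufficient
    set [Y], inclusion-exclusion computes the alternating sum of a family of
    closed sets as the number of points of [Y] in their union minus the number
    of edges of [Y] contained in one of them, and likewise inside [H].  The
    edges that are counted in [Y] and not in [H] do not outnumber the points,
    because [H] is self-sufficient.

    From alternating sums to the prerank ([sqsub_meet_embedded],
    [sqsub_rank_le]).  Families of two sets give the starred embedding.  Let [K]
    be finite with starred embedding in [G], between [H] and [G].  For the
    family of the closures of all flats of [K] of dimension at most [i], both
    alternating sums are numbers of points minus partial sums of the preranks.
    Hence the tails of the coefficients of [rho K] dominate those of [rho H],
    which is more than the lexicographic inequality.

    From the prerank to hypergraphs ([tight_extension]).  One may assume [G]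
    finite with the dimension of [H]: replace it by a finite self-sufficient set
    containing [H], represent this set anew, and keep the other edges
    ([replace_represents]).  By the starred embedding every set of points has a
    hull, the least flat of [H] whose closure contains it.  The prerank of a flat
    of [H] is then the number of edges with this hull minus the number of points
    outside [H] with this hull ([alpha_hull]), while in [G] an edge counts at its
    own closure.  So an edge contributes to a higher coefficient in [rho H] than
    in [rho G] when it is [spread], its dimension being less than that of its
    hull.  At the highest dimension of the hull of a spread edge or of a new
    point, minimality of the rank gives at least as many new points as spread
    edges ([spread_le_points]).  A minimal set of such points that meets at most
    as many spread edges as it has points satisfies Hall's condition
    ([peelable]); hence these points can be removed from the other edges
    through them without changing the geometry ([peel_represents]).  They then
    lie outside a smaller self-sufficient set, to which induction applies.
    Finally all the edges are shrunk to edges of nullity one by Zorn's lemma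
    ([good_shrink]), which makes the representation good. *)

(** * Finite sets and closure in a pregeometry *)

Section Pregeometry.
Variable M : choiceType.
Implicit Types (G H : pregeometry M) (Y P C : set M) (A B X : {fset M}).

Definition trace A C : {fset M} := [fset x in A | `[< C x >]]%fset.

Lemma in_trace A C x : (x \in trace A C) = (x \in A) && `[< C x >].
Proof. by rewrite !inE. Qed.

Lemma traceP A C x : reflect (x \in A /\ C x) (x \in trace A C).
Proof. by rewrite in_trace; apply: (iffP andP) => -[xA /asboolP Cx]. Qed.

Lemma trace_sub A C : (trace A C `<=` A)%fset.
Proof. by apply/fsubsetP => x /traceP[]. Qed.

Lemma trace_subset A C : [set` trace A C] `<=` C.
Proof. by move=> x /= /traceP[]. Qed.

Lemma traceS A B C : (A `<=` B)%fset -> [set` A] `<=` C -> (A `<=` trace B C)%fset.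
Proof.
by move=> /fsubsetP AB AsC; apply/fsubsetP => x xA; apply/traceP; split;
   [exact: AB|exact: AsC].
Qed.

Lemma fsub_set A B Y : (A `<=` B)%fset -> [set` B] `<=` Y -> [set` A] `<=` Y.
Proof. by move=> /fsubsetP AB BY x /= /AB; apply: BY. Qed.

Lemma fsetU_set A B Y :
  [set` A] `<=` Y -> [set` B] `<=` Y -> [set` (A `|` B)%fset] `<=` Y.
Proof. by move=> AY BY x /=; rewrite inE => /orP[]; [apply: AY|apply: BY]. Qed.

Lemma fset1U_set A x Y : Y x -> [set` A] `<=` Y -> [set` (x |` A)%fset] `<=` Y.
Proof. by move=> Yx AY y /=; rewrite !inE => /orP[/eqP->//|]; apply: AY. Qed.

Lemma fset0_set Y : [set` (fset0 : {fset M})] `<=` Y.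
Proof. by move=> x /=; rewrite inE. Qed.

Section OneGeometry.
Variable G : pregeometry M.
Local Notation V := (ground G).
Local Notation d := (gdim G).

Lemma fset_grow (P : {fset M} -> Prop) A :
  P A -> (forall B x, P B -> P (x |` B)%fset) -> forall B, P (A `|` B)%fset.
Proof.
move=> PA PS B; have [n] := ubnP #|` B|.
elim: n B => // n IH B; have [->|[x xB]] := fset_0Vmem B; first by rewrite fsetU0.
rewrite (cardfsD1 x) xB ltnS => ltB.
by rewrite -(fsetD1K xB) fsetUCA; apply: PS; apply: IH.
Qed.

Lemma gdim_mono A B : (A `<=` B)%fset -> [set` B] `<=` V -> d A <= d B.
Proof.
move=> AB BV; have -> : B = (A `|` B)%fset by apply/esym/fsetUidPr.
suff: [set` (A `|` B)%fset] `<=` V -> d A <= d (A `|` B)%fset.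
  by apply; rewrite (fsetUidPr _ _ AB).
apply: (@fset_grow (fun X => [set` X] `<=` V -> d A <= d X)) => // X x IH xXV.
have XV : [set` X] `<=` V := fsub_set (fsubsetU1 x X) xXV.
have Vx : V x by apply: xXV => /=; rewrite fset1U1.
by case/andP: (gdim_step XV Vx) => le1 _; apply: leq_trans (IH XV) le1.
Qed.

Lemma gdim_addn A B : [set` A] `<=` V -> [set` B] `<=` V ->
  d (A `|` B)%fset <= d A + #|` B|.
Proof.
move=> AV; have [n] := ubnP #|` B|; elim: n B => // n IH B.
have [->|[x xB]] := fset_0Vmem B; first by rewrite fsetU0 leq_addr.
rewrite (cardfsD1 x) xB ltnS => ltB BV; rewrite -{1}(fsetD1K xB) fsetUCA.
have BV' : [set` (B `\ x)%fset] `<=` V := fsub_set (fsubD1set B x) BV.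
have := IH _ ltB BV'.
have := gdim_step (fsetU_set AV BV') (BV x xB); lia.
Qed.

Lemma gdim_card A : [set` A] `<=` V -> d A <= #|` A|.
Proof.
by move=> AV; have := gdim_addn (@fset0_set V) AV; rewrite fset0U gdim0.
Qed.

(** Submodularity applied to [x |` A] and [B]. *)
Lemma gdim_stable A B x : V x -> (A `<=` B)%fset -> [set` B] `<=` V ->
  d (x |` A)%fset = d A -> d (x |` B)%fset = d B.
Proof.
move=> Vx AB BV dA; have AV := fsub_set AB BV.
have := gdim_submod (fset1U_set Vx AV) BV.
have -> : ((x |` A) `|` B = x |` B)%fset by rewrite -fsetUA (fsetUidPr _ _ AB).
have /gdim_mono -/(_ (fsub_set (fsubsetIr _ _) BV)) : (A `<=` (x |` A) `&` B)%fset.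
  by rewrite fsubsetI fsubsetU1.
have := gdim_step BV Vx; lia.
Qed.

Lemma gdim_spanned A B : [set` A] `<=` V -> [set` B] `<=` V ->
  (forall x, x \in B -> d (x |` A)%fset = d A) -> d (A `|` B)%fset = d A.
Proof.
move=> AV; have [n] := ubnP #|` B|; elim: n B => // n IH B.
have [->|[x xB]] := fset_0Vmem B; first by rewrite fsetU0.
rewrite (cardfsD1 x) xB ltnS => ltB BV dB; rewrite -(fsetD1K xB) fsetUCA.
have BV' : [set` (B `\ x)%fset] `<=` V := fsub_set (fsubD1set B x) BV.
rewrite -(IH _ ltB BV'); last by move=> y /fsetD1P[_ yB]; apply: dB.
by apply: gdim_stable (fsubsetUl A _) (fsetU_set AV BV') (dB x xB); apply: BV.
Qed.

(** Remove points as long as the dimension does not drop.  When every removal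
    lowers it, the same holds in all subsets by [gdim_stable], and the set is
    independent. *)
Lemma basis_exists A : [set` A] `<=` V ->
  exists B, [/\ (B `<=` A)%fset, d B = d A & #|` B| = d A].
Proof.
have [n] := ubnP #|` A|; elim: n A => // n IH A ltA AV.
have := gdim_card AV; rewrite leq_eqVlt => /orP[/eqP eqA|ltdA]; first by exists A.
have [x xA dx] : exists2 x, x \in A & d (A `\ x)%fset = d A.
  apply: contrapT => no; suff : #|` A| <= d A by lia.
  suff /(_ A (fsubset_refl A)) : forall B, (B `<=` A)%fset -> #|` B| <= d B by [].
  move=> B; have [m] := ubnP #|` B|; elim: m B => // m IHm B ltB BA.
  have [->|[x xB]] := fset_0Vmem B; first by rewrite cardfs0.
  have xA : x \in A := fsubsetP BA x xB.
  have BV := fsub_set BA AV; have AV' := fsub_set (fsubD1set A x) AV.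
  have := IHm (B `\ x)%fset; move: ltB; rewrite (cardfsD1 x B) xB add1n !ltnS.
  move=> ltB /(_ ltB (fsubset_trans (fsubD1set _ _) BA)).
  have Vx : V x by apply: AV.
  have st := gdim_stable Vx (fsetSD [fset x]%fset BA) AV'.
  have := gdim_step AV' Vx;
  have := gdim_step (fsub_set (fsubD1set B x) BV) Vx.
  rewrite (fsetD1K xA) (fsetD1K xB) in st *.
  have nA : d A <> d (A `\ x)%fset by move=> e; apply: no; exists x.
  case: (d B =P d (B `\ x)%fset) => [/st/nA[]|]; lia.
have ltD : #|` (A `\ x)%fset| < n by move: ltA; rewrite (cardfsD1 x) xA.
have [B [BA dB cB]] := IH _ ltD (fsub_set (fsubD1set A x) AV).
exists B; split; last by rewrite cB.
  exact: fsubset_trans BA (fsubD1set _ _).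
by rewrite dB.
Qed.

Lemma clP A x : [set` A] `<=` V ->
  cl G [set` A] x <-> V x /\ d (x |` A)%fset = d A.
Proof.
move=> AV; split=> [[Vx [B [BA dB]]]|[Vx dx]]; last by split=> //; exists A; split=> //; exact: subset_refl.
by split=> //; apply: (gdim_stable Vx _ AV dB); apply/fsubsetP.
Qed.

Lemma cl_ground Y : cl G Y `<=` V.
Proof. by move=> x []. Qed.

Lemma sub_cl Y : Y `<=` V -> Y `<=` cl G Y.
Proof.
move=> YV x Yx; split; first exact: YV.
exists [fset x]%fset; rewrite fsetUid; split=> // y /=.
by rewrite inE => /eqP->.
Qed.

Lemma cl_mono P Y : P `<=` Y -> cl G P `<=` cl G Y.
Proof.
by move=> PY x [Vx [A [AP dA]]]; split=> //; exists A; split=> // y /AP/PY.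
Qed.

Lemma cl_finite Y B : Y `<=` V -> [set` B] `<=` cl G Y ->
  exists A, [/\ [set` A] `<=` Y & forall x, x \in B -> d (x |` A)%fset = d A].
Proof.
move=> YV; have [n] := ubnP #|` B|; elim: n B => // n IH B.
have [->|[x xB]] := fset_0Vmem B; first by exists fset0; split=> //; apply: fset0_set.
rewrite (cardfsD1 x) xB ltnS => ltB Bcl.
have [A [AY dA]] := IH _ ltB (fsub_set (fsubD1set B x) Bcl).
have [Vx [A' [A'Y dx]]] := Bcl x xB.
have UY := fsetU_set AY A'Y; have UV := subset_trans UY YV.
exists (A `|` A')%fset; split=> // y yB.
have [->|neq] := eqVneq y x; first exact: gdim_stable (fsubsetUr _ _) UV dx.
have yB' : y \in (B `\ x)%fset by rewrite in_fsetD1 neq.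
apply: gdim_stable (fsubsetUl _ _) UV (dA y yB') => //.
by case: (Bcl y yB).
Qed.

Lemma cl_idem Y : Y `<=` V -> cl G (cl G Y) `<=` cl G Y.
Proof.
move=> YV x [Vx [B [BY dx]]]; have [A [AY dA]] := cl_finite YV BY.
split=> //; exists A; split=> //.
have AV := subset_trans AY YV; have BV := subset_trans BY (@cl_ground Y).
have dU := gdim_spanned AV BV dA.
have := gdim_stable Vx (fsubsetUr A B) (fsetU_set AV BV) dx; rewrite dU => dxU.
have := gdim_mono (fsetUS [fset x]%fset (fsubsetUl A B)).
move=> /(_ (fset1U_set Vx (fsetU_set AV BV))).
have := gdim_step AV Vx; lia.
Qed.

Lemma closed_cl Y : Y `<=` V -> closed G (cl G Y).
Proof.
move=> YV; split; first exact: cl_ground.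
by apply/seteqP; split; [exact: cl_idem|apply: sub_cl; exact: cl_ground].
Qed.

Lemma closedP Y : closed G Y <->
  Y `<=` V /\ forall A x, [set` A] `<=` Y -> V x -> d (x |` A)%fset = d A -> Y x.
Proof.
split=> [[YV clY]|[YV H]]; split=> //.
  by move=> A x AY Vx dx; rewrite -clY; split=> //; exists A.
apply/seteqP; split; last exact: sub_cl.
by move=> x [Vx [A [AY dx]]]; apply: H AY Vx dx.
Qed.

Lemma closed_sub P Y : closed G Y -> P `<=` Y -> cl G P `<=` Y.
Proof. by move=> [_ {2}<-]; apply: cl_mono. Qed.

Lemma closed_bigI (I : Type) (S : I -> Prop) (E : I -> set M) :
  (forall i, S i -> closed G (E i)) -> (exists i, S i) ->
  closed G [set x | forall i, S i -> E i x].
Proof.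
move=> cE [i0 Si0]; apply/closedP; split.
  by move=> x /(_ i0 Si0); case: (cE _ Si0) => EV _; apply: EV.
move=> A x AE Vx dx i Si; have [_] := (closedP _).1 (cE i Si); apply; last exact: dx.
  by move=> y /AE; apply.
by [].
Qed.

Lemma closedI P Y : closed G P -> closed G Y -> closed G (P `&` Y).
Proof.
move=> /closedP[PV cP] /closedP[YV cY]; apply/closedP; split.
  by move=> x [/PV].
by move=> A x AI Vx dx; split; [apply: (cP A)|apply: (cY A)] => // y /AI [].
Qed.

Lemma closed_ground : closed G V.
Proof. by apply/closedP; split. Qed.

Lemma gdim_in_cl A B : [set` A] `<=` V -> [set` B] `<=` cl G [set` A] -> d B <= d A.
Proof.
move=> AV BA; have BV := subset_trans BA (@cl_ground _).
rewrite -(gdim_spanned AV BV); last by move=> x /BA /clP[].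
by apply: gdim_mono (fsubsetUr _ _) (fsetU_set AV BV).
Qed.

Lemma cl_full A B : (A `<=` B)%fset -> [set` B] `<=` V -> d A = d B ->
  [set` B] `<=` cl G [set` A].
Proof.
move=> AB BV dAB x xB; have AV := fsub_set AB BV.
apply/clP => //; split; first exact: BV.
have := gdim_step AV (BV _ xB).
have : d (x |` A)%fset <= d B by apply: gdim_mono; rewrite // fsubUset fsub1set xB.
lia.
Qed.

(** Bases turn sizes of independent sets into dimensions of arbitrary ones. *)
Lemma is_dimP Y n : Y `<=` V ->
  is_dim G Y n <-> (exists2 A, [set` A] `<=` Y & d A = n) /\
                   (forall A, [set` A] `<=` Y -> d A <= n).
Proof.
move=> YV; split=> -[[A]].
  move=> [AY iA cA] max; split=> [|B BY]; first by exists A => //; rewrite iA.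
  have [B' [B'B dB' cB']] := basis_exists (subset_trans BY YV).
  by rewrite -cB'; apply: max; [exact: fsub_set B'B BY|rewrite /independent dB'].
move=> AY dA max; have [B [BA dB cB]] := basis_exists (subset_trans AY YV).
split; first by exists B; split; [exact: fsub_set BA AY|rewrite /independent dB|rewrite cB].
by move=> B' B'Y <-; apply: max.
Qed.

Lemma is_dim_uniq Y m n : is_dim G Y m -> is_dim G Y n -> m = n.
Proof.
move=> [[A [AY iA <-]] max1] [[B [BY iB <-]] max2].
by apply/eqP; rewrite eqn_leq max2 // max1.
Qed.

Lemma dimE Y n : is_dim G Y n -> dim G Y = n.
Proof. by move=> dY; apply: xget_unique => // m dm; apply: is_dim_uniq dm dY. Qed.

Lemma is_dim_between A Y : [set` A] `<=` V -> [set` A] `<=` Y ->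
  Y `<=` cl G [set` A] -> is_dim G Y (d A).
Proof.
move=> AV AY Ycl; apply/is_dimP; first exact: subset_trans Ycl (@cl_ground _).
by split; [exists A|move=> B BY; apply: gdim_in_cl => // x /BY/Ycl].
Qed.

Lemma is_dim_fset A : [set` A] `<=` V -> is_dim G [set` A] (d A).
Proof. by move=> AV; apply: is_dim_between => //; apply: sub_cl. Qed.

End OneGeometry.
End Pregeometry.

(** * Subpregeometries *)

Section Sub.
Variable M : choiceType.
Implicit Types (G H K : pregeometry M) (X Y P C E : set M) (A B : {fset M}).

Lemma restr_submod G P A B :
  [set` A] `<=` ground G `&` P -> [set` B] `<=` ground G `&` P ->
  gdim G (A `|` B)%fset + gdim G (A `&` B)%fset <= gdim G A + gdim G B.
Proof. by move=> AV BV; apply: gdim_submod => x => [/AV|/BV] []. Qed.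

Lemma restr_step G P A x :
  [set` A] `<=` ground G `&` P -> (ground G `&` P) x ->
  gdim G A <= gdim G (x |` A)%fset <= (gdim G A).+1.
Proof. by move=> AV [Vx _]; apply: gdim_step => // y /AV []. Qed.

Definition restr G P : pregeometry M :=
  Pregeometry (gdim0 G) (@restr_step G P) (@restr_submod G P).

Lemma restr_sub G P : subpregeometry (restr G P) G.
Proof. by split=> // x []. Qed.

Lemma ground_restr G P : P `<=` ground G -> ground (restr G P) = P.
Proof. by move=> PV; apply/seteqP; split=> [x []//|x Px]; split=> //; apply: PV. Qed.

Lemma subpregeometry_refl G : subpregeometry G G.
Proof. by split. Qed.

Lemma subpregeometry_trans K H G :
  subpregeometry K H -> subpregeometry H G -> subpregeometry K G.
Proof.
move=> [KH eKH] [HG eHG]; split; first exact: subset_trans KH HG.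
by move=> A AK; rewrite eKH // eHG //; apply: subset_trans AK KH.
Qed.

Section SubG.
Variables H G : pregeometry M.
Hypothesis HG : subpregeometry H G.
Let VH : ground H `<=` ground G := HG.1.
Let dH := HG.2.

Lemma cl_subE Y : Y `<=` ground H -> cl H Y = cl G Y `&` ground H.
Proof.
move=> YH; apply/seteqP; split=> [x [Hx [A [AY dx]]]|x [[Vx [A [AY dx]]] Hx]].
  split=> //; split; first exact: VH.
  have AH := subset_trans AY YH.
  by exists A; split=> //; rewrite -!dH //; apply: fset1U_set.
have AH := subset_trans AY YH.
by split=> //; exists A; split=> //; rewrite !dH //; apply: fset1U_set.
Qed.

Lemma closed_subE X : closed H X -> cl G X `&` ground H = X.
Proof. by move=> [XH clX]; rewrite -cl_subE. Qed.

Lemma closed_trace E : closed G E -> closed H (E `&` ground H).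
Proof.
move=> [EV clE]; split; first by move=> x [].
apply/seteqP; split; last by apply: sub_cl => x [].
rewrite cl_subE; last by move=> x [].
move=> x [xcl Hx]; split=> //; rewrite -clE.
by apply: cl_mono xcl => y [].
Qed.

Lemma closed_ground_sub X : closed H X -> X `<=` ground G.
Proof. by move=> [XH _]; apply: subset_trans XH VH. Qed.

(** What the starred embedding says without dimensions; see [sqsub_starP]. *)
Definition meet_embedded : Prop := forall X1 X2 : set M,
  closed H X1 -> closed H X2 -> cl G X1 `&` cl G X2 `<=` cl G (X1 `&` X2).

Hypothesis finH : finite_set (ground H).

Lemma finite_closed X : closed H X -> exists A, X = [set` A].
Proof.
by move=> [XH _]; apply/finite_fsetP; apply: sub_finite_set XH finH.
Qed.

(** Both intersections contain [X1 `&` X2], so that equal dimensions mean equal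
    closures. *)
Lemma sqsub_starP : sqsub_star H G <-> meet_embedded.
Proof.
split=> [star X1 X2 c1 c2|meet X1 X2 c1 c2 n].
  have c12 := closedI c1 c2.
  have [A eA] := finite_closed c12; have AH : [set` A] `<=` ground H.
    by rewrite -eA; case: c12.
  have AV := subset_trans AH VH.
  have dim12 : is_dim G (cl G X1 `&` cl G X2) (gdim G A).
    by apply/star => //; rewrite eA -dH //; apply: is_dim_fset.
  have UV : cl G X1 `&` cl G X2 `<=` ground G by move=> x [/cl_ground].
  have [_ max] := (is_dimP _ UV).1 dim12.
  move=> x xcl; rewrite eA; apply/clP => //; split; first exact: UV.
  suff : gdim G (x |` A)%fset <= gdim G A.
    by have := gdim_step AV (UV _ xcl); lia.
  apply: max; apply: fset1U_set => // y yA.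
  have [y1 y2] : (X1 `&` X2) y by rewrite eA.
  by split; apply: sub_cl => //; apply: closed_ground_sub.
have c12 := closedI c1 c2.
have [A eA] := finite_closed c12; have AH : [set` A] `<=` ground H.
  by rewrite -eA; case: c12.
have AV := subset_trans AH VH.
have dim12 : is_dim G (cl G X1 `&` cl G X2) (gdim G A).
  apply: is_dim_between => //; last by rewrite -eA; apply: meet.
  rewrite -eA => y [y1 y2].
  by split; apply: sub_cl => //; apply: closed_ground_sub.
have dim12' : is_dim H (X1 `&` X2) (gdim G A).
  by rewrite eA -dH //; apply: is_dim_fset.
by split=> dn; rewrite (is_dim_uniq dn dim12') || rewrite (is_dim_uniq dn dim12).
Qed.

(** The closures of the closed sets of [H] form a family stable under
    intersection; the least one around [T] comes from a closed set of [H] with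
    the fewest points. *)
Lemma hull_exists (T : set M) : meet_embedded -> T `<=` cl G (ground H) ->
  exists A, closed H [set` A] /\
    forall B, closed H [set` B] -> (T `<=` cl G [set` B] <-> (A `<=` B)%fset).
Proof.
move=> meet Tcl.
pose Q n := `[< exists A, [/\ closed H [set` A], T `<=` cl G [set` A] & #|` A| = n] >].
have [A0 eA0] := (@finite_fsetP _ _).1 finH.
have exQ : exists n, Q n.
  by exists #|` A0|; apply/asboolP; exists A0; rewrite -eA0; split=> //; apply: closed_ground.
have [n /asboolP[A [cA TA cardA]] minn] := ex_minnP exQ.
exists A; split=> // B cB; split=> [TB|AB]; last first.
  by apply: subset_trans TA _; apply: cl_mono => x /(fsubsetP AB).
have eI : [set` (A `&` B)%fset] = [set` A] `&` [set` B].
  by apply/seteqP; split=> [x /fsetIP[]//|x [? ?]]; apply/fsetIP.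
have : n <= #|` (A `&` B)%fset|.
  apply: minn; apply/asboolP; exists (A `&` B)%fset; split=> //.
    by rewrite eI; apply: closedI.
  by rewrite eI => x Tx; apply: meet => //; split; [apply: TA|apply: TB].
rewrite -cardA => leA; apply/fsetIidPl/eqP.
by have [_ <-] := fsubset_leqif_cards (fsubsetIl A B); rewrite eqn_leq leA
   fsubset_leq_card // fsubsetIl.
Qed.

End SubG.

Lemma meet_embedded_refl G : meet_embedded G G.
Proof.
move=> X1 X2 [X1V e1] [X2V e2]; rewrite e1 e2; apply: sub_cl.
by move=> x [/X1V].
Qed.

Lemma cl_cl_sub K G Y : subpregeometry K G -> Y `<=` ground K ->
  cl G (cl K Y) = cl G Y.
Proof.
move=> KG YK; have YV := subset_trans YK KG.1.
apply/seteqP; split; last by apply: cl_mono; apply: sub_cl.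
apply: closed_sub; first exact: closed_cl.
by rewrite (cl_subE KG) // => x [].
Qed.

Lemma meet_embedded_trans H K G : subpregeometry H K -> subpregeometry K G ->
  meet_embedded H K -> meet_embedded K G -> meet_embedded H G.
Proof.
move=> HK KG mHK mKG X1 X2 c1 c2.
have X1K := closed_ground_sub HK c1; have X2K := closed_ground_sub HK c2.
rewrite -(cl_cl_sub KG X1K) -(cl_cl_sub KG X2K).
have := mKG _ _ (closed_cl X1K) (closed_cl X2K); move/subset_trans; apply.
rewrite -[X in _ `<=` X](cl_cl_sub KG); last by move=> x [/X1K].
by apply: cl_mono; apply: mHK.
Qed.

Lemma meet_embedded_restr H K G : subpregeometry H K -> subpregeometry K G ->
  meet_embedded H G -> meet_embedded H K.
Proof.
move=> HK KG mHG X1 X2 c1 c2.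
have X1K := closed_ground_sub HK c1; have X2K := closed_ground_sub HK c2.
rewrite !(cl_subE KG) //; last by move=> x [/X1K].
by move=> x [[x1 Kx] [x2 _]]; split=> //; apply: mHG.
Qed.

End Sub.

(** * Indexed representations *)

Section Representation.
Variables (M I : choiceType).
Implicit Types (G H : pregeometry M) (A B X Y Z P : {fset M}) (C : set M).
Implicit Types (R : set I) (f g : I -> {fset M}) (S : {fset I}) (e : I).

Definition inside R f Y S : Prop := forall e, e \in S -> R e /\ (f e `<=` Y)%fset.

(** A hypergraph whose edges are indexed by [R], so that an edge can be changed
    without changing its name and edges that become equal still count apart.
    The last two clauses say that [gdim G] is the least predimension of a
    superset; quantifying over finite sets [S] of edges makes sense of this
    before one knows that finitely many edges lie within [Y]. *)
Definition represents R f G : Prop :=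
  [/\ forall e, R e -> [set` f e] `<=` ground G,
      forall Y S, [set` Y] `<=` ground G -> inside R f Y S ->
        gdim G Y + #|` S| <= #|` Y| &
      forall X, [set` X] `<=` ground G -> exists Y S,
        [/\ (X `<=` Y)%fset, [set` Y] `<=` ground G, inside R f Y S &
            #|` Y| = gdim G X + #|` S|]].

Definition edges_within R f Y : {fset I} :=
  fset_set [set e | R e /\ (f e `<=` Y)%fset].

(** Self-sufficiency: the predimension of [Y] is least among its supersets. *)
Definition tight R f G Y : Prop :=
  #|` Y| = gdim G Y + #|` edges_within R f Y|.

Section OneRepresentation.
Variables (R : set I) (f : I -> {fset M}) (G : pregeometry M).
Hypothesis rep : represents R f G.
Local Notation V := (ground G).
Local Notation d := (gdim G).
Local Notation ins := (edges_within R f).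
Local Notation tight := (tight R f G).

Lemma edges_withinP Y e : [set` Y] `<=` V ->
  reflect (R e /\ (f e `<=` Y)%fset) (e \in ins Y).
Proof.
have [_ bound _] := rep => YV.
suff fin : finite_set [set e | R e /\ (f e `<=` Y)%fset].
  by rewrite in_fset_set //; apply: (iffP idP) => [/set_mem|/mem_set].
apply: contrapT => inf; have [S SI cS] := infinite_set_fset #|` Y|.+1 inf.
by have := bound Y S YV SI; lia.
Qed.

Lemma edges_within_bound Y : [set` Y] `<=` V -> d Y + #|` ins Y| <= #|` Y|.
Proof.
by have [_ bound _] := rep => YV; apply: bound => // e /edges_withinP; apply.
Qed.

Lemma inside_sub Y S : [set` Y] `<=` V -> inside R f Y S -> (S `<=` ins Y)%fset.
Proof. by move=> YV SY; apply/fsubsetP => e /SY ?; apply/edges_withinP. Qed.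

Lemma tight_above X : [set` X] `<=` V ->
  exists Y, [/\ (X `<=` Y)%fset, [set` Y] `<=` V, d Y = d X & tight Y].
Proof.
have [_ _ attain] := rep => XV; have [Y [S [XY YV SY cY]]] := attain X XV.
have := edges_within_bound YV; have := fsubset_leq_card (inside_sub YV SY).
have := gdim_mono XY YV.
by move=> leX leS leY; exists Y; split=> //; rewrite ?/tight; lia.
Qed.

Lemma edges_withinS X Y : (X `<=` Y)%fset -> [set` Y] `<=` V ->
  (ins X `<=` ins Y)%fset.
Proof.
move=> XY YV; apply: inside_sub => // e /edges_withinP[|Re eX].
  exact: fsub_set XY YV.
by split=> //; apply: fsubset_trans eX XY.
Qed.

Lemma edges_withinI X Y : [set` X] `<=` V -> [set` Y] `<=` V ->
  (ins X `&` ins Y = ins (X `&` Y))%fset.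
Proof.
move=> XV YV; have IV := fsub_set (fsubsetIl X Y) XV.
apply/eqP; rewrite eqEfsubset; apply/andP; split.
  apply: inside_sub => // e /fsetIP[/edges_withinP-/(_ XV)[Re eX]].
  by move=> /edges_withinP-/(_ YV)[_ eY]; rewrite fsubsetI eX.
by rewrite fsubsetI !edges_withinS ?fsubsetIl ?fsubsetIr.
Qed.

Lemma edges_within_supermod X Y : [set` X] `<=` V -> [set` Y] `<=` V ->
  #|` ins X| + #|` ins Y| <= #|` ins (X `|` Y)%fset| + #|` ins (X `&` Y)%fset|.
Proof.
move=> XV YV; have UV := fsetU_set XV YV.
rewrite -cardfsUI edges_withinI // leq_add2r fsubset_leq_card // fsubUset.
by rewrite !edges_withinS ?fsubsetUl ?fsubsetUr.
Qed.

(** Let [Z] be a superset of the trace of least predimension.  It has the same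
    closure as the trace, hence it lies in [C] and meets [Y] in the trace.  By
    submodularity of the predimension for [Z] and [Y], where [Y] is
    self-sufficient, the trace has no larger predimension than [Z]. *)
Lemma tight_trace Y C : [set` Y] `<=` V -> tight Y -> closed G C ->
  tight (trace Y C).
Proof.
move=> YV tY cC; have TV := fsub_set (@trace_sub _ Y C) YV.
have [Z [TZ ZV dZ tZ]] := tight_above TV.
have ZC : [set` Z] `<=` C.
  apply: subset_trans (cl_full TZ ZV _) _; first by rewrite dZ.
  by apply: closed_sub => //; apply: trace_subset.
have eI : (Z `&` Y)%fset = trace Y C.
  apply/eqP; rewrite eqEfsubset fsubsetI TZ trace_sub traceS ?fsubsetIr //.
  exact: fsub_set (fsubsetIl Z Y) ZC.
have := edges_within_supermod ZV YV; have := edges_within_bound (fsetU_set ZV YV).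
have := edges_within_bound TV; have := cardfsUI Z Y; rewrite eI.
have := gdim_mono (fsubsetUr Z Y) (fsetU_set ZV YV).
rewrite /tight in tY tZ *; lia.
Qed.

(** Only the lower bound on predimensions is at stake: the sets that attain the
    dimension contain at least the same edges after these have shrunk. *)
Lemma represents_shrink g : (forall e, (g e `<=` f e)%fset) ->
  (forall Y S, [set` Y] `<=` V -> inside R g Y S -> d Y + #|` S| <= #|` Y|) ->
  represents R g G.
Proof.
have [fV _ attain] := rep => gf bound; split=> // [e Re|X XV].
  exact: fsub_set (gf e) (fV e Re).
have [Y [S [XY YV SY cY]]] := attain X XV; exists Y, S; split=> // e /SY[Re eY].
by split=> //; apply: fsubset_trans (gf e) eY.
Qed.

Lemma edge_dim e : R e -> d (f e) < #|` f e|.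
Proof.
have [fV bound _] := rep => Re; have := bound (f e) [fset e]%fset (fV e Re).
rewrite cardfs1 addn1; apply=> e'; rewrite inE => /eqP->; split=> //.
Qed.

(** An edge of nullity at least two can lose a point.  If neither of two points
    [x], [x'] outside a basis of the edge can be removed, there are tight sets
    inside the closure of the edge that miss only [x], only [x'].  They and
    their intersection have the dimension of the edge, while their union gains
    the edge: this contradicts submodularity. *)
Lemma shrink_edge e0 : R e0 -> (d (f e0)).+1 < #|` f e0| ->
  exists g, [/\ represents R g G, forall e, (g e `<=` f e)%fset & g e0 != f e0].
Proof.
have [fV bound _] := rep => Re0 big; apply: contrapT => no.
have e0V := fV _ Re0.
have obstacle x : x \in f e0 -> exists Y,
    [/\ (f e0 `\ x `<=` Y)%fset, x \notin Y, [set` Y] `<=` cl G [set` f e0],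
        [set` Y] `<=` V & tight Y].
  move=> xe0; pose g e := if e == e0 then (f e `\ x)%fset else f e.
  have gf e : (g e `<=` f e)%fset.
    by rewrite /g; case: ifP => // _; apply: fsubD1set.
  have [Y [S [YV SY ltY]]] : exists Y S,
      [/\ [set` Y] `<=` V, inside R g Y S & #|` Y| < d Y + #|` S|].
    apply: contrapT => noY; apply: no; exists g; split=> //.
      apply: represents_shrink => // Y S YV SY; rewrite leqNgt; apply/negP => lt.
      by apply: noY; exists Y, S.
    by rewrite /g eqxx; apply/eqP => e; move: xe0; rewrite -e !inE eqxx.
  have nfS : ~ inside R f Y S by move=> /(bound _ _ YV); lia.
  have S'Y : inside R f Y (S `\ e0)%fset.
    by move=> e /fsetD1P[ne /SY]; rewrite /g (negPf ne).
  have e0S : e0 \in S.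
    apply: contrapT => ne0; apply: nfS => e eS; apply: S'Y.
    by rewrite in_fsetD1 eS andbT; apply: contra_notN ne0 => /eqP <-.
  have [_] := SY _ e0S; rewrite /g eqxx => e0Y.
  have xY : x \notin Y.
    apply: contra_notN nfS => xY e eS; have [->|ne] := eqVneq e e0.
      by split=> //; rewrite -(fsetD1K xe0) fsubUset e0Y fsub1set xY.
    by apply: S'Y; rewrite in_fsetD1 ne.
  have tY : tight Y.
    have := edges_within_bound YV; have := fsubset_leq_card (inside_sub YV S'Y).
    by rewrite /tight; move: ltY; rewrite (cardfsD1 e0 S) e0S; lia.
  exists (trace Y (cl G [set` f e0])); split.
  - apply: traceS => // y /fsetD1P[_ ye]; exact: sub_cl.
  - by apply: contra xY => /traceP[].
  - exact: trace_subset.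
  - exact: fsub_set (@trace_sub _ _ _) YV.
  - by apply: tight_trace => //; apply: closed_cl.
(* Two points outside a basis exist because the nullity is at least two. *)
have [B [Be dB cB]] := basis_exists e0V.
have := cardfsDS Be; rewrite cB => cD.
have [x xD] : exists x, x \in (f e0 `\` B)%fset.
  by apply/fset0Pn; rewrite -cardfs_gt0; lia.
have [x' x'D] : exists x', x' \in ((f e0 `\` B) `\ x)%fset.
  apply/fset0Pn; rewrite -cardfs_gt0.
  by move: cD; rewrite (cardfsD1 x) xD; lia.
case/fsetDP: xD => xe xB; case/fsetD1P: x'D => nx /fsetDP[x'e x'B].
have [Y [eY xY Ycl YV tY]] := obstacle x xe.
have [Y' [eY' xY' Y'cl Y'V tY']] := obstacle x' x'e.
have BY : (B `<=` Y)%fset.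
  by apply: fsubset_trans eY; rewrite fsubsetD1 Be.
have BY' : (B `<=` Y')%fset.
  by apply: fsubset_trans eY'; rewrite fsubsetD1 Be.
have IV := fsub_set (fsubsetIl Y Y') YV; have UV := fsetU_set YV Y'V.
have dY : d Y = d (f e0).
  by apply/eqP; rewrite eqn_leq gdim_in_cl //= -dB gdim_mono.
have dY' : d Y' = d (f e0).
  by apply/eqP; rewrite eqn_leq gdim_in_cl //= -dB gdim_mono.
have := gdim_mono (fsubsetUl Y Y') UV.
have : d B <= d (Y `&` Y')%fset by rewrite gdim_mono // fsubsetI BY.
have e0U : e0 \in ins (Y `|` Y')%fset.
  apply/edges_withinP => //; split=> //; apply/fsubsetP => y ye; rewrite inE.
  have [->|ne] := eqVneq y x.
    by apply/orP; right; apply: (fsubsetP eY'); rewrite in_fsetD1 eq_sym nx.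
  by apply/orP; left; apply: (fsubsetP eY); rewrite in_fsetD1 ne.
have sub : (ins Y `|` ins Y' `<=` ins (Y `|` Y') `\ e0)%fset.
  apply/fsubsetP => e; rewrite in_fsetU in_fsetD1 => eYY'; apply/andP; split.
    apply/eqP => ee; move: eYY'; rewrite ee => /orP[] /edges_withinP.
      by move=> /(_ YV)[_ /fsubsetP/(_ x xe)]; rewrite (negPf xY).
    by move=> /(_ Y'V)[_ /fsubsetP/(_ x' x'e)]; rewrite (negPf xY').
  by case/orP: eYY'; apply/fsubsetP/edges_withinS;
     rewrite ?fsubsetUl ?fsubsetUr.
have := cardfsUI (ins Y) (ins Y'); rewrite edges_withinI //.
have := fsubset_leq_card sub; have := cardfsUI Y Y'.
have := edges_within_bound UV; have := edges_within_bound IV.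
move: tY tY'; rewrite (cardfsD1 e0 (ins (Y `|` Y')%fset)) e0U /tight; lia.
Qed.

End OneRepresentation.
Arguments edges_withinP [R f G] rep [Y e] YV.

(** By Zorn's lemma all the edges can be shrunk at once: an edge is finite, so
    along a chain of representations it is eventually constant, and each
    instance of the bound involves finitely many edges. *)
Lemma good_shrink R f G : represents R f G ->
  exists g, [/\ represents R g G, forall e, (g e `<=` f e)%fset &
    forall e, R e -> #|` g e| = (gdim G (g e)).+1].
Proof.
move=> rep.
pose T := {g : I -> {fset M} | represents R g G /\ forall e, (g e `<=` f e)%fset}.
pose val (t : T) := proj1_sig t.
pose le (s t : T) := `[< forall e, (val t e `<=` val s e)%fset >].
have t0 : T by exists f.
have le_refl t : le t t by apply/asboolP.
have le_trans r s t : le r s -> le s t -> le r t.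
  move=> /asboolP rs /asboolP st; apply/asboolP => e.
  exact: fsubset_trans (st e) (rs e).
have chains (A : set T) : total_on A le -> exists t, forall s, A s -> le s t.
  move=> tot; have [[s0 As0]|none] := pselect (exists s, A s); last first.
    by exists t0 => s As; case: none; exists s.
  have least e : exists t, A t /\ forall s, A s -> (val t e `<=` val s e)%fset.
    pose Q n := `[< exists2 t, A t & #|` val t e| = n >].
    have exQ : exists n, Q n by exists #|` val s0 e|; apply/asboolP; exists s0.
    have [n /asboolP[t At ct] minn] := ex_minnP exQ; exists t; split=> // s As.
    have [/asboolP//|/asboolP/(_ e) st] := tot s t As At.
    suff /eqP <- : val s e == val t e by apply: fsubset_refl.
    have [_ <-] := fsubset_leqif_cards st.
    rewrite eqn_leq fsubset_leq_card //= ct; apply: minn.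
    by apply/asboolP; exists s.
  have [t tP] := choice least.
  pose g e := val (t e) e.
  have common S : exists2 s, A s & forall e, e \in S -> (val s e `<=` g e)%fset.
    have [n] := ubnP #|` S|; elim: n S => // n IH S.
    have [->|[e eS]] := fset_0Vmem S; first by exists s0.
    rewrite (cardfsD1 e) eS ltnS => /IH[s As sP].
    have [Ate _] := tP e.
    have split_e (r : T) : le s r -> le (t e) r ->
        forall e', e' \in S -> (val r e' `<=` g e')%fset.
      move=> /asboolP sr /asboolP tr e' e'S.
      have [->|ne] := eqVneq e' e; first exact: tr.
      by apply: fsubset_trans (sr e') (sP _ _); rewrite in_fsetD1 ne.
    have [st|ts] := tot s (t e) As Ate; first by exists (t e) => //; apply: split_e.
    by exists s => //; apply: split_e.
  have gf e : (g e `<=` f e)%fset by rewrite /g /val; case: (t e) => ? [].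
  have repg : represents R g G.
    apply: (represents_shrink rep) => // Y S YV SY; have [s As sP] := common S.
    have [_ bound _] : represents R (val s) G by rewrite /val; case: (s) => ? [].
    apply: bound => // e eS; have [Re gY] := SY e eS.
    by split=> //; apply: fsubset_trans (sP e eS) gY.
  have Tg : represents R g G /\ forall e, (g e `<=` f e)%fset by [].
  by exists (exist _ g Tg) => s As; apply/asboolP => e; case: (tP e) => _; apply.
have [[g [repg gf]] max] := ZL_preorder t0 le_refl le_trans chains.
exists g; split=> // e Re; apply: contrapT => nge.
have big : (gdim G (g e)).+1 < #|` g e|.
  by have := edge_dim repg Re; rewrite leq_eqVlt => /orP[/eqP/esym|].
have [h [reph hg hne]] := shrink_edge repg Re big.
have Th : represents R h G /\ forall e, (h e `<=` f e)%fset.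
  by split=> // e'; apply: fsubset_trans (hg e') (gf e').
have gh : le (exist _ g (conj repg gf)) (exist _ h Th) by apply/asboolP.
have /asboolP/(_ e) /= gh' := max _ gh.
by case/negP: hne; rewrite eqEfsubset hg gh'.
Qed.
End Representation.
Arguments edges_withinP [M I R f G] rep [Y e] YV.

(** * Changing a representation *)

Section Surgery.
Variables (M I : choiceType).
Implicit Types (G H : pregeometry M) (A B X Y Z P N : {fset M}) (C : set M).
Implicit Types (R : set I) (f g : I -> {fset M}) (S : {fset I}) (e : I).

Definition edges_of R f P : set I := [set e | R e /\ (f e `<=` P)%fset].

Definition replace_in R f P g (e : I) : {fset M} :=
  if `[< edges_of R f P e >] then g e else f e.

Lemma sub_trace_cl G A P : (A `<=` P)%fset -> [set` P] `<=` ground G ->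
  (A `<=` trace P (cl G [set` A]))%fset.
Proof.
by move=> AP PV; apply: traceS => //; apply: sub_cl; apply: fsub_set AP PV.
Qed.

Lemma gdim_trace_cl G A P : (A `<=` P)%fset -> [set` P] `<=` ground G ->
  gdim G (trace P (cl G [set` A])) = gdim G A.
Proof.
move=> AP PV; have TV := fsub_set (@trace_sub _ P (cl G [set` A])) PV.
apply/eqP; rewrite eqn_leq (gdim_mono (sub_trace_cl AP PV) TV) andbT.
by apply: gdim_in_cl; [apply: fsub_set AP PV|apply: trace_subset].
Qed.

Lemma ground_tight R f G P : represents R f G -> ground G = [set` P] ->
  tight R f G P.
Proof.
move=> rep eP; have PG : [set` P] `<=` ground G by rewrite eP.
have [Y [PY YP dY tY]] := tight_above rep PG.
suff eY : Y = P by rewrite eY in tY.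
by apply/eqP; rewrite eqEfsubset PY andbT; apply/fsubsetP => x /YP; rewrite eP.
Qed.

Section Replace.
Variables (R : set I) (f : I -> {fset M}) (G : pregeometry M) (P : {fset M}).
Hypotheses (rep : represents R f G) (PV : [set` P] `<=` ground G).
Hypothesis tP : tight R f G P.
Variable g : I -> {fset M}.
Let GP := restr G [set` P].
Hypothesis repg : represents (edges_of R f P) g GP.
Local Notation V := (ground G).
Local Notation d := (gdim G).
Let g' := replace_in R f P g.

Let groundP : ground GP = [set` P].
Proof. exact: ground_restr. Qed.

Let PtoV X : (X `<=` P)%fset -> [set` X] `<=` V.
Proof. by move=> XP; apply: fsub_set PV. Qed.

Let PtoGP X : (X `<=` P)%fset -> [set` X] `<=` ground GP.
Proof. by move=> XP; rewrite groundP; apply: fsub_set XP _. Qed.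

(** The edges of [S] within [P] are bounded by the nullity of [Y `&` P], by
    means of [g].  The others are counted against the closure [W] of [Y `&` P]
    in [P], which is self-sufficient and has the dimension of [Y `&` P]. *)
Lemma replace_bound Y S : [set` Y] `<=` V -> inside R g' Y S ->
  d Y + #|` S| <= #|` Y|.
Proof.
move=> YV SY; have [_ boundg _] := repg.
pose S1 := [fset e in S | `[< edges_of R f P e >]]%fset.
have YP := fsubsetIr Y P; have YPV := fsub_set (fsubsetIl Y P) YV.
have inS1 : inside (edges_of R f P) g (Y `&` P)%fset S1.
  move=> e; rewrite !inE => /andP[eS /asboolP Pe]; split=> //.
  have [_] := SY e eS; rewrite /g' /replace_in asboolT // => gY.
  rewrite fsubsetI gY /=; have [gV _ _] := repg; have := gV e Pe.
  by rewrite groundP => gP; apply/fsubsetP.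
have b1 : d (Y `&` P)%fset + #|` S1| <= #|` (Y `&` P)%fset|.
  by apply: boundg inS1; apply: PtoGP.
pose W := trace P (cl G [set` (Y `&` P)%fset]).
have WP : (W `<=` P)%fset := trace_sub _ _.
have WV := PtoV WP.
have YPW : (Y `&` P `<=` W)%fset := sub_trace_cl YP PV.
have tW : tight R f G W by apply: tight_trace => //; apply: closed_cl.
have dW : d W = d (Y `&` P)%fset := gdim_trace_cl YP PV.
have UV := fsetU_set YV WV.
have S2U : (S `\` S1 `<=` edges_within R f (Y `|` W) `\` edges_within R f W)%fset.
  apply/fsubsetP => e /fsetDP[eS].
  move=> eS1; have /asboolPn nPe : ~~ `[< edges_of R f P e >].
    by apply: contra eS1 => Pe; rewrite !inE eS.
  have [Re] := SY e eS; rewrite /g' /replace_in asboolF // => fY.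
  apply/fsetDP; split; last first.
    apply/negP => /(edges_withinP rep WV)[_ fW]; apply: nPe; split=> //.
    exact: fsubset_trans fW WP.
  apply/(edges_withinP rep UV); split=> //.
  by apply: fsubset_trans fY (fsubsetUl _ _).
have := edges_within_bound rep UV; have := gdim_mono (fsubsetUl Y W) UV.
have := fsubset_leq_card S2U.
rewrite (cardfsDS (edges_withinS rep (fsubsetUr Y W) UV)).
have := fsubset_leq_card (edges_withinS rep (fsubsetUr Y W) UV).
have S1S : (S1 `<=` S)%fset by apply: fset_sub.
rewrite (cardfsDS S1S); have := fsubset_leq_card S1S.
have := cardfsUI Y W; have -> : (Y `&` W = Y `&` P)%fset.
  apply/eqP; rewrite eqEfsubset fsetIS //= fsubsetI fsubsetIl; exact: YPW.
by rewrite /tight dW in tW; lia.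
Qed.

(** A self-sufficient part can be represented anew, keeping the edges outside
    it.  A flat of [G] meets [P] in a flat of [P], where both representations
    count the same number of edges; so the same sets attain the dimension. *)
Lemma replace_represents : represents R g' G.
Proof.
have [fV _ _] := rep; have [gV _ _] := repg.
split=> [e Re||X XV]; last first.
- have [Z [XPZ ZV _ tZ]] := tight_above rep (fsetU_set XV PV).
  have cX : closed G (cl G [set` X]) := closed_cl XV.
  pose X' := trace Z (cl G [set` X]).
  have XZ : (X `<=` Z)%fset := fsubset_trans (fsubsetUl X P) XPZ.
  have XX' : (X `<=` X')%fset := sub_trace_cl XZ ZV.
  have X'V : [set` X'] `<=` V := fsub_set (@trace_sub _ _ _) ZV.
  have tX' : tight R f G X' by apply: tight_trace.
  have dX' : d X' = d X := gdim_trace_cl XZ ZV.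
  pose Q := trace P (cl G [set` X]).
  have QE : Q = (X' `&` P)%fset.
    apply/fsetP => x; rewrite in_fsetI !in_trace [LHS]andbC [RHS]andbAC andbC.
    congr (_ && _); case xP: (x \in P); last by rewrite andbF.
    by rewrite andbT; apply/esym/(fsubsetP XPZ); rewrite in_fsetU xP orbT.
  have QP : (Q `<=` P)%fset := trace_sub _ _.
  have tQ : tight R f G Q by apply: tight_trace.
  have tP' : tight (edges_of R f P) g GP P.
    exact: ground_tight repg groundP.
  have tQ' : tight (edges_of R f P) g GP Q.
    have PGP := PtoGP (fsubset_refl P).
    have := tight_trace repg PGP tP' (closed_trace (restr_sub G [set` P]) cX).
    suff -> : trace P (cl G [set` X] `&` ground GP) = Q by [].
    apply/fsetP => x; rewrite !in_trace; case xP: (x \in P) => //=.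
    apply: asbool_equiv_eq; split=> [[]|xcl] //; split=> //; split=> //; exact: PV.
  exists X', (edges_within (edges_of R f P) g Q `|`
              (edges_within R f X' `\` edges_within R f Q))%fset; split=> //.
    move=> e; rewrite in_fsetU => /orP[/(edges_withinP repg (PtoGP QP))[Pe gQ]|].
      split; first by case: Pe.
      rewrite /g' /replace_in asboolT //; apply: fsubset_trans gQ _.
      by rewrite QE fsubsetIl.
    case/fsetDP=> /(edges_withinP rep X'V)[Re fX'] /(edges_withinP rep (PtoV QP)) nQ.
    split=> //; rewrite /g' /replace_in asboolF // => -[_ fP]; apply: nQ.
    by rewrite QE fsubsetI fX'.
  have QX' : (Q `<=` X')%fset by rewrite QE fsubsetIl.
  rewrite cardfsU (cardfsDS (edges_withinS rep QX' X'V)).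
  have -> : (edges_within (edges_of R f P) g Q `&`
      (edges_within R f X' `\` edges_within R f Q) = fset0)%fset.
    apply/fsetP => e; rewrite in_fset0; apply/negP => /fsetIP[].
    move=> /(edges_withinP repg (PtoGP QP))[[_ fP] gQ].
    case/fsetDP=> /(edges_withinP rep X'V)[Re fX'] /(edges_withinP rep (PtoV QP)).
    by apply; rewrite QE fsubsetI fX'.
  rewrite cardfs0; have := fsubset_leq_card (edges_withinS rep QX' X'V).
  rewrite /tight /= in tX' tQ tQ'; lia.
- exact: replace_bound.
- rewrite /g' /replace_in; case: asboolP => Pe; last exact: fV.
  by apply: subset_trans (gV e Pe) _; rewrite groundP.
Qed.

Lemma replace_tight X : (X `<=` P)%fset ->
  tight (edges_of R f P) g GP X -> tight R g' G X.
Proof.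
move=> XP tX; have XGP := PtoGP XP.
have := edges_within_bound replace_represents (PtoV XP).
have /fsubset_leq_card : (edges_within (edges_of R f P) g X `<=`
                          edges_within R g' X)%fset.
  apply: (inside_sub replace_represents (PtoV XP)) => e.
  move=> /(edges_withinP repg XGP)[Pe gX]; split; first by case: Pe.
  by rewrite /g' /replace_in asboolT.
by rewrite /tight /= in tX *; lia.
Qed.
End Replace.

Section Peel.
Variables (R : set I) (f : I -> {fset M}) (G : pregeometry M).
Variables (V N : {fset M}) (L : {fset I}) (K : M -> {fset M}).
Hypotheses (rep : represents R f G) (groundG : ground G = [set` V]).
Let C e := trace V (cl G [set` f e]).
(** Removal of the points [N]: all edges are enlarged to their closures, which is
    harmless, and those outside a set [L] of as many edges then lose [N].  In
    the application [K p] is the closure of the hull of [p]. *)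
Definition peel e : {fset M} := if e \in L then C e else (C e `\` N)%fset.
Hypotheses (LR : forall e, e \in L -> R e) (NV : (N `<=` V)%fset).
Hypothesis hall : forall Z, (Z `<=` N)%fset ->
  #|` Z| <= #|` [fset e in L | (C e `&` Z != fset0)%fset]%fset|.
Hypothesis inner : forall e p, e \in L -> p \in N -> p \in C e -> (C e `<=` K p)%fset.
Hypothesis outer : forall e p, R e -> e \notin L -> p \in N -> p \in C e ->
  (K p `<=` C e)%fset.
Hypothesis nested : forall p q, p \in N -> q \in N -> q \in K p -> (K q `<=` K p)%fset.

Let VG : [set` V] `<=` ground G.
Proof. by rewrite groundG. Qed.

Let fC e : R e -> (f e `<=` C e)%fset.
Proof.
have [fV _ _] := rep => Re; apply: sub_trace_cl => //.
by apply/fsubsetP => x xe; have := fV e Re x xe; rewrite groundG.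
Qed.

(** Only sets [Y] containing an edge that has lost points of [N] are in question.
    To such a [Y] add the set [Z] of the points of [N] whose associated set [K]
    lies in [Y] up to points of [N].  The sum contains the closures of all the
    edges of [Y], and also those of the edges of [L] that meet [Z], which are not
    edges of [Y]; by Hall's condition they compensate for [Z], and the bound for
    the original representation gives the one wanted. *)
Lemma peel_represents : represents R peel G.
Proof.
have [fV bound attain] := rep.
have peelC e : (peel e `<=` C e)%fset.
  by rewrite /peel; case: ifP => _ //; apply: fsubsetDl.
split=> [e Re|Y S YV SY|X XV].
- apply: subset_trans VG; apply: fsub_set (peelC e) _.
  exact: fsub_set (@trace_sub _ _ _) _.
- pose Z := [fset p in N | (p \notin Y) && (K p `<=` Y `|` N)%fset]%fset.
  pose T := [fset e in L | (C e `&` Z != fset0)%fset]%fset.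
  have ZN : (Z `<=` N)%fset by apply: fset_sub.
  have inZ p : (p \in Z) = [&& p \in N, p \notin Y & (K p `<=` Y `|` N)%fset].
    by rewrite !inE.
  have inT e : (e \in T) = (e \in L) && (C e `&` Z != fset0)%fset by rewrite !inE.
  have SL e : e \in S -> e \in L -> (C e `<=` Y)%fset.
    by move=> eS eL; have [_] := SY e eS; rewrite /peel eL.
  have CSU e : e \in S -> (C e `<=` Y `|` Z)%fset.
    move=> eS; case eL: (e \in L); first exact: fsubset_trans (SL e eS eL) (fsubsetUl _ _).
    have [Re] := SY e eS; rewrite /peel eL fsubDset => CY.
    apply/fsubsetP => q qC; rewrite in_fsetU; case qY: (q \in Y) => //=.
    have := fsubsetP CY q qC; rewrite in_fsetU qY orbF => qN.
    rewrite inZ qN qY /= fsetUC; apply: fsubset_trans CY.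
    by apply: outer => //; rewrite eL.
  have CTU e : e \in T -> (C e `<=` Y `|` Z)%fset.
    rewrite inT => /andP[eL /fset0Pn[p /fsetIP[pC]]].
    rewrite inZ => /and3P[pN pY KpY].
    apply/fsubsetP => q qC; rewrite in_fsetU; case qY: (q \in Y) => //=.
    have CK := inner eL pN pC; have qK := fsubsetP CK q qC.
    have := fsubsetP KpY q qK; rewrite in_fsetU qY /= => qN.
    by rewrite inZ qN qY /=; apply: fsubset_trans (nested pN qN qK) KpY.
  have disj : (S `&` T = fset0)%fset.
    apply/fsetP => e; rewrite in_fset0; apply/negP => /fsetIP[eS].
    rewrite inT => /andP[eL /fset0Pn[p /fsetIP[pC]]].
    by rewrite inZ (fsubsetP (SL e eS eL) p pC) andbF.
  have disjYZ : (Y `&` Z = fset0)%fset.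
    apply/fsetP => p; rewrite in_fset0; apply/negP => /fsetIP[pY].
    by rewrite inZ pY andbF.
  have UV : [set` (Y `|` Z)%fset] `<=` ground G.
    apply: fsetU_set => //; rewrite groundG.
    by apply: fsub_set (fsubset_trans ZN NV) _.
  have insU : inside R f (Y `|` Z)%fset (S `|` T)%fset.
    move=> e; rewrite in_fsetU => /orP[eS|eT].
      have [Re _] := SY e eS; split=> //.
      exact: fsubset_trans (fC Re) (CSU e eS).
    have Re : R e by move: eT; rewrite inT => /andP[/LR].
    by split=> //; apply: fsubset_trans (fC Re) (CTU e eT).
  have := bound _ _ UV insU; have := gdim_mono (fsubsetUl Y Z) UV.
  have := cardfsUI S T; have := cardfsUI Y Z; rewrite disj disjYZ !cardfs0.
  by have := hall ZN; rewrite -/T; lia.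
- have XVf : (X `<=` V)%fset by apply/fsubsetP => x /XV; rewrite groundG.
  pose Y := trace V (cl G [set` X]).
  have YV : [set` Y] `<=` ground G := fsub_set (@trace_sub _ _ _) VG.
  have tV := ground_tight rep groundG.
  have tY : tight R f G Y by apply: tight_trace => //; apply: closed_cl.
  exists Y, (edges_within R f Y); split=> //; first exact: sub_trace_cl.
    move=> e /(edges_withinP rep YV)[Re eY]; split=> //.
    apply: fsubset_trans (peelC e) _; apply: traceS; first exact: trace_sub.
    apply: subset_trans (@trace_subset _ _ _) _.
    apply: closed_sub; first exact: closed_cl.
    apply: subset_trans (@trace_subset _ V _).
    by move=> x; apply: (fsubsetP eY).
  by rewrite /tight gdim_trace_cl in tY.
Qed.

Lemma peel_tight : #|` L| = #|` N| -> gdim G (V `\` N)%fset = gdim G V ->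
  tight R peel G (V `\` N)%fset.
Proof.
move=> cL dVN.
have DV : [set` (V `\` N)%fset] `<=` ground G by apply: fsub_set VG; apply: fsubsetDl.
have := edges_within_bound peel_represents DV.
have tV := ground_tight rep groundG.
have sub : (edges_within R f V `\` L `<=` edges_within R peel (V `\` N))%fset.
  apply: (inside_sub peel_represents DV) => e.
  case/fsetDP=> /(edges_withinP rep VG)[Re _] eL; split=> //.
  by rewrite /peel (negPf eL) fsetSD // trace_sub.
have LV : (L `<=` edges_within R f V)%fset.
  apply: (inside_sub rep VG) => e /LR Re; split=> //.
  exact: fsubset_trans (fC Re) (@trace_sub _ _ _).
have := fsubset_leq_card sub; have := fsubset_leq_card LV; have := fsubset_leq_card NV.
rewrite (cardfsDS LV) cardfsDS // /tight cardfsDS //; rewrite /tight in tV; lia.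
Qed.
End Peel.
End Surgery.

(** * Alternating sums *)

Section InclusionExclusion.
Local Open Scope ring_scope.

(** Expand the product over all [i] of [1 - (i \in A)]. *)
Lemma sum_sign_subsets (k : nat) (A : {set 'I_k}) :
  \sum_(s : {set 'I_k} | s \subset A) (-1) ^+ #|s| = (A == finset.set0)%:R :> int.
Proof.
have := @bigA_distr int 0 1 *%R +%R 'I_k (fun i => - (i \in A)%:R) (fun=> 1).
have -> : \prod_(i : 'I_k) (- (i \in A)%:R + 1) = (A == finset.set0)%:R :> int.
  have [->|[x xA]] := set_0Vmem A.
    by rewrite eqxx big1 // => i _; rewrite finset.in_set0 oppr0 add0r.
  rewrite (bigD1 x) //= xA addNr mul0r; case: eqP => // e0.
  by move: xA; rewrite e0 finset.in_set0.
move=> ->; rewrite big_mkcond /=; apply: eq_bigr => s _; rewrite -big_mkcond /=.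
case: ifPn => [sA|/fintype.subsetPn[x xs xA]]; last first.
  by rewrite (bigD1 x) //= (negPf xA) oppr0 mul0r.
rewrite (eq_bigr (fun=> -1)); last by move=> i /(fintype.subsetP sA) ->.
by rewrite prodr_const.
Qed.

Lemma inclusion_exclusion (k : nat) (T : Type) (r : seq T) (w : T -> int)
    (Q : 'I_k -> pred T) :
  \sum_(s : {set 'I_k} | s != finset.set0)
     (-1) ^+ #|s|.+1 * \sum_(t <- r | [forall i in s, Q i t]) w t
  = \sum_(t <- r | [exists i, Q i t]) w t.
Proof.
rewrite (eq_bigr (fun s : {set 'I_k} => \sum_(t <- r)
  (-1) ^+ #|s|.+1 * (if [forall i in s, Q i t] then w t else 0))); last first.
  by move=> s _; rewrite big_mkcond big_distrr.
rewrite exchange_big /= [RHS]big_mkcond /=; apply: eq_bigr => t _.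
pose A : {set 'I_k} := finset.finset (fun i => Q i t).
have eA (s : {set 'I_k}) : [forall i in s, Q i t] = (s \subset A).
  by apply/forall_inP/fintype.subsetP => H i /H; rewrite inE.
have -> : [exists i, Q i t] = (A != finset.set0).
  by apply/existsP/finset.set0Pn => -[i Qi]; exists i; rewrite inE in Qi *.
have := sum_sign_subsets A; rewrite (bigD1 finset.set0) ?finset.sub0set //= cards0 expr0.
move=> e1; rewrite (eq_bigr (fun s : {set 'I_k} =>
  (if s \subset A then (-1) ^+ #|s| else 0) * - w t)); last first.
  by move=> s _; rewrite eA exprS; case: ifP => _; rewrite ?mulr0 ?mul0r // mulN1r mulrN mulNr.
rewrite -big_distrl /= -big_mkcondr /=.
have -> : \sum_(s : {set 'I_k} | (s != finset.set0) && (s \subset A)) (-1) ^+ #|s|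
  = (A == finset.set0)%:R - 1 :> int.
  by rewrite -e1 addrAC subrr add0r; apply: eq_bigl => s; rewrite andbC.
by case: (A == finset.set0) => /=; rewrite ?subrr ?mul0r // sub0r mulN1r opprK.
Qed.

Lemma cardfs_sum (T : choiceType) (A : {fset T}) (Q : pred T) :
  (#|` [fset x in A | Q x]%fset|)%:Z = \sum_(x <- A | Q x) 1.
Proof. by rewrite card_fset_sum1 big_fset /= (big_morph Posz PoszD (erefl _)). Qed.

(** An alternating sum of differences of two measures, the number of points and
    a weight [w], is evaluated by inclusion-exclusion. *)
Lemma Delta_eq (M T : choiceType) (G : pregeometry M) (k : nat)
    (E : 'I_k -> set M) (A : {fset M}) (P : 'I_k -> pred M)
    (S : {fset T}) (w : T -> int) (Q : 'I_k -> pred T) :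
  (forall s : {set 'I_k}, s != finset.set0 ->
     (dim G [set x | forall i, i \in s -> E i x])%:Z =
     \sum_(x <- A | [forall i in s, P i x]) 1 -
     \sum_(t <- S | [forall i in s, Q i t]) w t) ->
  Delta G E = (#|` [fset x in A | [exists i, P i x]]%fset|)%:Z -
              \sum_(t <- S | [exists i, Q i t]) w t.
Proof.
move=> dimE; rewrite /Delta cardfs_sum -!inclusion_exclusion -sumrB.
by apply: eq_bigr => s /dimE ->; rewrite mulrBr.
Qed.

End InclusionExclusion.

Section TightSqsub.
Variables (M I : choiceType).
Implicit Types (G H K : pregeometry M) (A B X Y Z P : {fset M}) (C : set M).
Implicit Types (R : set I) (f : I -> {fset M}).

Definition meet_of k (E : 'I_k -> set M) (s : {set 'I_k}) : set M :=
  [set x | forall i, i \in s -> E i x].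

Lemma closed_meet_of G k (E : 'I_k -> set M) (s : {set 'I_k}) :
  (forall i, closed G (E i)) -> s != finset.set0 -> closed G (meet_of E s).
Proof.
by move=> cE /finset.set0Pn[i si]; apply: closed_bigI; [move=> j _|exists i].
Qed.

Lemma finite_dim_sub G C C' : C `<=` ground G -> finite_dim G C -> C' `<=` C ->
  exists2 A, [set` A] `<=` C' & is_dim G C' (gdim G A).
Proof.
move=> CV [n dn] C'C; have [_ max] := (is_dimP _ CV).1 dn.
pose Q m := `[< exists2 A, [set` A] `<=` C' & gdim G A = m >].
have exQ : exists m, Q m.
  by exists 0; apply/asboolP; exists fset0; [apply: fset0_set|apply: gdim0].
have ubQ m : Q m -> m <= n.
  by move=> /asboolP[A AC' <-]; apply: max; apply: subset_trans AC' C'C.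
have [m /asboolP[A AC' dA] maxm] := ex_maxnP exQ ubQ.
exists A => //; apply/is_dimP; first exact: subset_trans C'C CV.
split=> [|B BC']; first by exists A.
by rewrite dA; apply: maxm; apply/asboolP; exists B.
Qed.

Lemma finite_cover (T : eqType) (r : seq T) (a : T -> {fset M}) (C : set M) :
  (forall t, t \in r -> [set` a t] `<=` C) ->
  exists2 B, [set` B] `<=` C & forall t, t \in r -> (a t `<=` B)%fset.
Proof.
elim: r => [_|t r IH aC]; first by exists fset0 => //; apply: fset0_set.
have [|B BC aB] := IH; first by move=> u ur; apply: aC; rewrite inE ur orbT.
exists (a t `|` B)%fset.
  by apply: fsetU_set => //; apply: aC; rewrite inE eqxx.
move=> u; rewrite inE => /orP[/eqP->|/aB uB]; first exact: fsubsetUl.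
exact: fsubset_trans uB (fsubsetUr _ _).
Qed.

(** The traces of the intersections on [Y] are self-sufficient, so each of their
    dimensions is a number of points minus a number of edges.  The family [F] in
    [K] is either the family itself or its trace on a subgeometry. *)
Lemma Delta_tight R f G K Y k (E F : 'I_k -> set M) :
  represents R f G -> [set` Y] `<=` ground G -> tight R f G Y ->
  (forall i, closed G (E i)) ->
  (forall s, s != finset.set0 ->
     dim K (meet_of F s) = gdim G (trace Y (meet_of E s))) ->
  Delta K F =
    ((#|` [fset x in Y | [exists i, `[< E i x >]]]%fset|)%:Z -
     (#|` [fset e in edges_within R f Y |
            [exists i, `[< ([set` f e] `<=` E i)%classic >]]]%fset|)%:Z)%R.
Proof.
move=> rep YV tY cE dimF; rewrite [X in (_ - X)%R]cardfs_sum; apply: Delta_eq => s s0.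
have tT := tight_trace rep YV tY (closed_meet_of cE s0).
rewrite -/(meet_of F s) dimF // -!cardfs_sum.
set A := [fset x in Y | _]%fset; set S := [fset e in edges_within R f Y | _]%fset.
have TV := fsub_set (@trace_sub _ Y (meet_of E s)) YV.
have -> : A = trace Y (meet_of E s).
  apply/fsetP => x; rewrite in_trace !inE /=; congr (_ && _).
  apply/forall_inP/asboolP => [H i si|H i si]; last by apply/asboolP; apply: H.
  by apply/asboolP; apply: H.
have -> : S = edges_within R f (trace Y (meet_of E s)).
  apply/fsetP => e; rewrite !inE /=; apply/andP/(edges_withinP rep TV).
    case=> /(edges_withinP rep YV)[Re fY] /forall_inP fE; split=> //.
    by apply: traceS => // x xe i si; have /asboolP := fE i si; apply.
  case=> Re fT; split.
    by apply/(edges_withinP rep YV); split=> //; apply: fsubset_trans fT (trace_sub _ _).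
  apply/forall_inP => i si; apply/asboolP => x /(fsubsetP fT) /traceP[_].
  exact.
by rewrite /tight in tT; lia.
Qed.

(** Over a self-sufficient [Y] containing [P] and bases of all the intersections
    both alternating sums count points minus edges.  The edges counted for [G]
    only lie within the union of [P] and the points counted for [G]; as [P] is
    self-sufficient, they do not outnumber the points outside [P]. *)
Lemma tight_sqsub R f G H P : represents R f G -> subpregeometry H G ->
  ground H = [set` P] -> tight R f G P -> sqsub H G.
Proof.
move=> rep HG eP tP k E cfE.
have PV : [set` P] `<=` ground G by rewrite -eP; apply: HG.1.
have cE i : closed G (E i) by case: (cfE i).
have /choice[a aP] : forall s : {set 'I_k}, exists A, s != finset.set0 ->
    [set` A] `<=` meet_of E s /\ is_dim G (meet_of E s) (gdim G A).
  move=> s.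
  have [->|s0] := eqVneq s finset.set0; first by exists fset0.
  have /finset.set0Pn[i si] := s0; have [ci fi] := cfE i.
  have sub : meet_of E s `<=` E i by move=> x; apply.
  by have [A AE dA] := finite_dim_sub ci.1 fi sub; exists A.
have [|B BV aB] := @finite_cover _ (enum [pred s : {set 'I_k} | s != finset.set0]) a (ground G).
  move=> s; rewrite mem_enum inE => s0; have [aE _] := aP s s0.
  by apply: subset_trans aE _; case: (closed_meet_of cE s0).
have [Y [PBY YV _ tY]] := tight_above rep (fsetU_set PV BV).
have PY := fsubset_trans (fsubsetUl P B) PBY.
have BY := fsubset_trans (fsubsetUr P B) PBY.
rewrite (Delta_tight rep YV tY cE (K := G) (F := E)); last first.
  move=> s s0; apply: dimE; have [aE dim_s] := aP s s0.
  have cs := closed_meet_of cE s0; have [_ max] := (is_dimP _ cs.1).1 dim_s.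
  suff -> : gdim G (trace Y (meet_of E s)) = gdim G (a s) by [].
  apply/eqP; rewrite eqn_leq max; last exact: trace_subset.
  apply: gdim_mono; last by apply: fsub_set YV; apply: trace_sub.
  by apply: traceS => //; apply: fsubset_trans BY; apply: aB; rewrite mem_enum inE.
rewrite (Delta_tight rep PV tP cE (K := H)); last first.
  move=> s s0; apply: dimE; have TP := @trace_sub _ P (meet_of E s).
  have TH : [set` trace P (meet_of E s)] `<=` ground H by rewrite eP; apply: fsub_set TP _.
  suff -> : meet_of (fun i => E i `&` ground H) s = [set` trace P (meet_of E s)].
    by rewrite -HG.2 //; apply: is_dim_fset.
  apply/seteqP; split=> [x xE|x /traceP[xP xE] i si]; last first.
    by split; [apply: xE|rewrite eP].
  apply/traceP; split; last by move=> i /xE [].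
  by have /finset.set0Pn[i /xE[_]] := s0; rewrite eP.
set U := [fset x in Y | _]%fset; set W := [fset e in edges_within R f Y | _]%fset.
set UP := [fset x in P | _]%fset; set WP := [fset e in edges_within R f P | _]%fset.
have UY : (U `<=` Y)%fset by apply: fset_sub.
have UV := fsub_set UY YV.
have eUP : UP = (U `&` P)%fset.
  apply/fsetP => x; rewrite /UP /U !inE /=; case xP: (x \in P); last by rewrite andbF.
  by rewrite (fsubsetP PY x xP) /= andbT.
have eWP : WP = (W `&` edges_within R f P)%fset.
  apply/fsetP => e; rewrite /WP /W !inE /=.
  case eP': (e \in edges_within R f P); last by rewrite andbF.
  by rewrite (fsubsetP (edges_withinS rep PY YV) e eP') /= andbT.
have PUV := fsetU_set PV UV.
have sub : (edges_within R f P `|` W `<=` edges_within R f (P `|` U))%fset.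
  rewrite fsubUset (edges_withinS rep) ?fsubsetUl //=.
  apply: (inside_sub rep PUV) => e; rewrite !inE /=.
  case/andP=> /(edges_withinP rep YV)[Re fY] /existsP[i /asboolP fE]; split=> //.
  apply: fsubset_trans (fsubsetUr P U); apply/fsubsetP => x xe.
  by rewrite !inE /= (fsubsetP fY) //=; apply/existsP; exists i; apply/asboolP; apply: fE.
have := fsubset_leq_card sub; have := edges_within_bound rep PUV.
have := gdim_mono (fsubsetUl P U) PUV.
have := cardfsUI P U; have := cardfsUI (edges_within R f P) W.
rewrite fsetIC -eWP (fsetIC P) -eUP; rewrite /tight in tP; lia.
Qed.

End TightSqsub.

(** * The prerank *)

Section Prerank.
Variable M : choiceType.
Implicit Types (G H K : pregeometry M) (A B X Y V : {fset M}) (C : set M).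

Definition vertices G : {fset M} := fset_set (ground G).

Definition flats G : {fset {fset M}} :=
  [fset X in fpowerset (vertices G) | `[< closed G [set` X] >]]%fset.

Lemma ground_vertices G : finite_set (ground G) -> [set` vertices G] = ground G.
Proof. exact: fset_setK. Qed.

Lemma in_flats G X : finite_set (ground G) ->
  reflect (closed G [set` X]) (X \in flats G).
Proof.
move=> fin; rewrite !inE /= fpowersetE.
apply: (iffP andP) => [[_ /asboolP//]|cX]; split; last exact/asboolP.
by apply/fsubsetP => x xX; have := cX.1 x xX; rewrite -ground_vertices.
Qed.

Lemma sub_vertices G X : finite_set (ground G) -> [set` X] `<=` ground G ->
  (X `<=` vertices G)%fset.
Proof. by move=> fin XG; apply/fsubsetP => x /XG; rewrite -ground_vertices. Qed.

Local Open Scope ring_scope.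

Lemma flat_sumE G (w : {fset M} -> int) (Q : pred {fset M}) :
  \sum_(X <- flats G | Q X) w X =
  \sum_(X <- fpowerset (vertices G) | `[< closed G [set` X] >] && Q X) w X.
Proof. by rewrite big_fset_condE [RHS]big_fset_condE; apply: eq_fbigl => X; rewrite !inE /= andbA. Qed.

Lemma sum_flats_split G (w : {fset M} -> int) X :
  finite_set (ground G) -> closed G [set` X] ->
  \sum_(Y <- flats G | (Y `<=` X)%fset) w Y =
  w X + \sum_(Y <- flats G | (Y `<` X)%fset) w Y.
Proof.
move=> fin cX; rewrite (bigID (pred1 X)) /=; congr (_ + _); last first.
  by apply: eq_bigl => Y; rewrite fproperEneq andbC.
rewrite -big_filter (_ : [seq _ <- _ | _] = [:: X]) ?big_seq1 //.
rewrite (eq_filter (a2 := pred1 X)); last first.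
  by move=> Y /=; case: eqP => [->|]; rewrite ?fsubset_refl ?andbF.
by apply: filter_pred1_uniq; [apply: fset_uniq|apply/in_flats].
Qed.

Lemma alpha_sum G X : finite_set (ground G) -> closed G [set` X] ->
  \sum_(Y <- flats G | (Y `<=` X)%fset) alpha G Y =
  (#|` X|%N)%:Z - (gdim G X)%:Z.
Proof.
move=> fin cX; have XV := sub_vertices fin cX.1.
rewrite sum_flats_split // [alpha G X]alphaE.
rewrite (_ : \sum_(Y <- flats G | _) _ = \sum_(Y <- fpowerset X |
  (Y `<` X)%fset && `[< closed G [set` Y] >]) alpha G Y) ?subrK //.
apply: eq_fbigl_cond => Y; rewrite !inE /= !fpowersetE.
case YX: (Y `<` X)%fset; last by rewrite !(andbF, andFb).
have YX' := fproper_sub YX; rewrite YX' (fsubset_trans YX' XV) /=.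
by rewrite !andbT.
Qed.

(** Moebius inversion over the flats. *)
Lemma alpha_unique G (w : {fset M} -> int) : finite_set (ground G) ->
  (forall X, closed G [set` X] ->
    \sum_(Y <- flats G | (Y `<=` X)%fset) w Y = (#|` X|%N)%:Z - (gdim G X)%:Z) ->
  forall X, closed G [set` X] -> alpha G X = w X.
Proof.
move=> fin sumw X; have [n] := ubnP #|` X|; elim: n X => // n IH X ltX cX.
have := sumw X cX; rewrite -(alpha_sum fin cX) !sum_flats_split //.
have -> : \sum_(Y <- flats G | (Y `<` X)%fset) alpha G Y =
          \sum_(Y <- flats G | (Y `<` X)%fset) w Y.
  apply: eq_fbigr => Y /(in_flats _ fin) cY YX; apply: IH => //.
  exact: leq_trans (fproper_ltn_card YX) _.
by move/addIr.
Qed.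

Definition rho_coef G (i : nat) : int :=
  \sum_(X <- flats G | gdim G X == i) alpha G X.

Lemma rhoE G i : (rho G)@_(Some i) = rho_coef G i.
Proof.
rewrite /rho mcoeffD mcoeffU mulr0n add0r raddf_sum /rho_coef flat_sumE.
rewrite [RHS]big_mkcondr; apply: eq_bigr => X _; rewrite [LHS]mcoeffU.
have -> : (Some (gdim G X) == Some i) = (gdim G X == i) by [].
by case: eqP.
Qed.

Lemma rho_top G : (rho G)@_None = (gdim G (vertices G))%:Z.
Proof.
rewrite /rho mcoeffD mcoeffU mulr1n raddf_sum big1 ?addr0 // => X _.
by rewrite [LHS]mcoeffU.
Qed.

Lemma rho_coef_large G i : finite_set (ground G) ->
  (gdim G (vertices G) < i)%N -> rho_coef G i = 0.
Proof.
move=> fin lti; apply: big1_fset => X /(in_flats _ fin) cX /eqP dX.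
have : (gdim G X <= gdim G (vertices G))%N.
  by apply: gdim_mono; [apply: sub_vertices => //; case: cX|rewrite ground_vertices].
by rewrite dX leqNgt lti.
Qed.

Definition rho_upto G (i : nat) : int :=
  \sum_(X <- flats G | (gdim G X <= i)%N) alpha G X.

Lemma rho_upto0 G : rho_upto G 0 = rho_coef G 0.
Proof. by apply: eq_bigl => X; rewrite leqn0. Qed.

Lemma rho_uptoS G i : rho_upto G i.+1 = rho_upto G i + rho_coef G i.+1.
Proof.
rewrite /rho_upto (bigID (fun X => (gdim G X <= i)%N)) /=; congr (_ + _).
  by apply: eq_bigl => X; case: (leqP (gdim G X) i) => h; rewrite ?andbF // andbT (leq_trans h).
by apply: eq_bigl => X; rewrite -ltnNge eqn_leq.
Qed.

Lemma rho_upto_top G i : finite_set (ground G) ->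
  (gdim G (vertices G) <= i)%N ->
  rho_upto G i = (#|` vertices G|%N)%:Z - (gdim G (vertices G))%:Z.
Proof.
move=> fin lei; have cV : closed G [set` vertices G].
  by rewrite ground_vertices //; apply: closed_ground.
rewrite -alpha_sum // /rho_upto big_seq_cond [RHS]big_seq_cond; apply: eq_bigl => X.
case cX: (X \in flats G) => //=; have /(in_flats _ fin) {}cX := cX.
have XV : (X `<=` vertices G)%fset by apply: sub_vertices => //; case: cX.
rewrite XV; apply: leq_trans lei; apply: gdim_mono => //.
by rewrite ground_vertices.
Qed.

(** Let [j] be the highest degree where the coefficients differ.  The partial
    sums up to [j] differ by [m], as the total sums do, and those below [j] by at
    most [m]; so the coefficient at [j] is larger for [G]. *)
Lemma omod_le_tails H G m : finite_set (ground H) -> finite_set (ground G) ->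
  gdim H (vertices H) = gdim G (vertices G) ->
  (#|` vertices H| + m = #|` vertices G|)%N ->
  (forall i, rho_upto G i - rho_upto H i <= m%:Z) ->
  omod_le (rho H) (rho G).
Proof.
move=> finH finG dHG cardm upto.
have [same|] := pselect (forall i, rho_coef H i = rho_coef G i).
  left; apply/malgP => -[i|]; first by rewrite !rhoE same.
  by rewrite !rho_top dHG.
move/existsNP => [i0 ne0]; right.
pose Q i := rho_coef H i != rho_coef G i.
have exQ : exists i, Q i by exists i0; apply/eqP.
have ubQ i : Q i -> (i <= gdim G (vertices G))%N.
  by rewrite leqNgt; apply: contra => lti; rewrite /Q !rho_coef_large ?dHG.
have [j Qj maxj] := ex_maxnP exQ ubQ.
have eq_above i : (j < i)%N -> rho_coef H i = rho_coef G i.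
  by rewrite ltnNge => /negP ji; apply/eqP; apply: contra_notT ji; apply: maxj.
exists (Some j); split; last first.
  by move=> [i|] //= ji; rewrite ?rhoE ?rho_top ?dHG // eq_above.
rewrite !rhoE.
have diff k : rho_upto G (j + k)%N - rho_upto H (j + k)%N =
              rho_upto G j - rho_upto H j.
  elim: k => [|k <-]; first by rewrite addn0.
  by rewrite addnS !rho_uptoS eq_above ?ltnS ?leq_addr // opprD addrACA subrr addr0.
have dm : rho_upto G j - rho_upto H j = m%:Z.
  rewrite -(diff (gdim G (vertices G))) !rho_upto_top ?leq_addl ?dHG //; lia.
have Qj' : rho_coef H j <> rho_coef G j by apply/eqP.
case: j {Qj maxj eq_above diff} Qj' dm => [|j] Qj; rewrite ?rho_upto0 ?rho_uptoS.
  lia.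
have := upto j; lia.
Qed.

End Prerank.

(** * Embeddings and the prerank *)

Section SqsubRank.
Variable M : choiceType.
Implicit Types (G H K N : pregeometry M) (A B X Y V : {fset M}) (C : set M).

Lemma Delta2 G (E : 'I_2 -> set M) :
  (Delta G E = (dim G (E ord0))%:Z + (dim G (E ord_max))%:Z
     - (dim G (E ord0 `&` E ord_max))%:Z)%R.
Proof.
pose s0 : {set 'I_2} := [set ord0]%SET; pose s1 : {set 'I_2} := [set ord_max]%SET.
have n01 : s1 != s0 by apply/eqP => /setP/(_ ord0); rewrite !inE.
have nT0 : (finset.setTfor 'I_2) != s0 by apply/eqP => /setP/(_ ord_max); rewrite !inE.
have nT1 : (finset.setTfor 'I_2) != s1 by apply/eqP => /setP/(_ ord0); rewrite !inE.
have ne0 (s : {set 'I_2}) i : i \in s -> s != finset.set0.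
  by move=> si; apply/finset.set0Pn; exists i.
rewrite /Delta (bigD1 s0) /=; last by apply: (ne0 _ ord0); rewrite inE.
rewrite (bigD1 s1) /=; last by rewrite n01 (ne0 _ ord_max) ?inE.
rewrite (bigD1 (finset.setTfor 'I_2)) /=; last first.
  by rewrite nT0 nT1 (ne0 _ ord0) ?inE.
rewrite big1 => [|s]; last first.
  case/andP=> /andP[/andP[sn0 sns0] sns1] snT; exfalso.
  have two (t : {set 'I_2}) : (ord0 \in s) = (ord0 \in t) ->
      (ord_max \in s) = (ord_max \in t) -> s = t.
    move=> e0 e1; apply/setP => i; have [->//|->//] : i = ord0 \/ i = ord_max.
    by case: i => [[|[|//]] h]; [left|right]; apply: val_inj.
  case b0: (ord0 \in s); case b1: (ord_max \in s).
  - by case/eqP: snT; apply: two; rewrite inE.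
  - by case/eqP: sns0; apply: two; rewrite ?b0 ?b1 inE.
  - by case/eqP: sns1; apply: two; rewrite ?b0 ?b1 inE.
  - by case/eqP: sn0; apply: two; rewrite ?b0 ?b1 inE.
rewrite addr0 !cards1 cardsT card_ord !exprS expr0 !mulr1 mulrNN mulr1 !mul1r mulN1r.
rewrite addrA; congr (_%:Z + _%:Z - _%:Z)%R; congr (dim G _); apply/seteqP.
- by split=> [x /(_ ord0)|x xE i]; rewrite inE; [apply|move/eqP->].
- by split=> [x /(_ ord_max)|x xE i]; rewrite inE; [apply|move/eqP->].
- split=> [x xE|x [x0 x1] i _]; first by split; apply: xE; rewrite inE.
  have [->//|->//] : i = ord0 \/ i = ord_max.
  by case: i => [[|[|//]] h]; [left|right]; apply: val_inj.
Qed.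

Lemma dim_cl_closed H G C : subpregeometry H G -> finite_set (ground H) ->
  closed H C -> is_dim G (cl G C) (dim H C).
Proof.
move=> HG fin cC; have [A eA] := finite_closed fin cC.
have AH : [set` A] `<=` ground H by rewrite -eA; case: cC.
have AV := subset_trans AH HG.1.
rewrite eA (dimE (is_dim_fset AH)) HG.2 //; apply: is_dim_between => //.
exact: sub_cl.
Qed.

(** The alternating sums of two closed sets of [H] and of their closures differ
    only in the dimensions of the two intersections. *)
Lemma sqsub_meet_embedded H G : subpregeometry H G -> finite_set (ground H) ->
  sqsub H G -> meet_embedded H G.
Proof.
move=> HG fin sq X1 X2 c1 c2.
have X1V := closed_ground_sub HG c1; have X2V := closed_ground_sub HG c2.
have c12 := closedI c1 c2; have [A eA] := finite_closed fin c12.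
have AH : [set` A] `<=` ground H by rewrite -eA; case: c12.
have AV := subset_trans AH HG.1.
pose E (i : 'I_2) := if i == ord0 then cl G X1 else cl G X2.
have := sq 2 E; have -> : (forall i, closed G (E i) /\ finite_dim G (E i)) <-> True.
  split=> // _ i; rewrite /E; case: ifP => _; split; try exact: closed_cl.
    by exists (dim H X1); apply: dim_cl_closed.
  by exists (dim H X2); apply: dim_cl_closed.
move=> /(_ Logic.I); rewrite !Delta2 /E /= !(closed_subE HG) //.
have [B BE dB] : exists2 B, [set` B] `<=` cl G X1 `&` cl G X2 &
    is_dim G (cl G X1 `&` cl G X2) (gdim G B).
  apply: (finite_dim_sub (C := cl G X1)); first exact: cl_ground.
    by exists (dim H X1); apply: dim_cl_closed.
  by move=> x [].
rewrite (dimE (dim_cl_closed HG fin c1)) (dimE (dim_cl_closed HG fin c2)).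
rewrite (dimE dB) eA (dimE (is_dim_fset AH)) HG.2 // => le.
have le' : gdim G B <= gdim G A by lia.
have IV : cl G X1 `&` cl G X2 `<=` ground G by move=> x [/cl_ground].
have [_ max] := (is_dimP _ IV).1 dB.
move=> x xcl; apply/clP => //; split; first exact: IV.
have : gdim G (x |` A)%fset <= gdim G B.
  apply: max; apply: fset1U_set => // y yA.
  have [y1 y2] : (X1 `&` X2) y by rewrite eA.
  by split; apply: sub_cl.
by have := gdim_step AV (IV _ xcl); lia.
Qed.

Local Open Scope ring_scope.

Section FlatFamily.
Variables (k : nat) (F : 'I_k -> {fset M}).

Definition common N (s : {set 'I_k}) : {fset M} :=
  [fset x in vertices N | [forall i in s, x \in F i]]%fset.

Lemma closed_common N s : finite_set (ground N) ->
  (forall i, closed N ([set` F i] `&` ground N)) -> s != finset.set0 ->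
  closed N [set` common N s].
Proof.
move=> fin cF s0; suff -> : [set` common N s] =
    [set x | forall i, i \in s -> ([set` F i] `&` ground N) x].
  by have /finset.set0Pn[i si] := s0; apply: closed_bigI; [move=> j _|exists i].
apply/seteqP; split=> x /=.
  rewrite !inE /= => /andP[xN /forall_inP xF] i si; split; first exact: xF.
  by rewrite -ground_vertices.
move=> xF; rewrite !inE /=; apply/andP; split; last first.
  by apply/forall_inP => i /xF [].
have /finset.set0Pn[i si] := s0; have [_] := xF i si.
by rewrite -ground_vertices.
Qed.

(** The counterpart of [Delta_tight] without a representation: by [alpha_sum]
    the prerank takes the place of the number of edges. *)
Lemma Delta_flats G N (E : 'I_k -> set M) : finite_set (ground N) ->
  (forall i, closed N ([set` F i] `&` ground N)) ->
  (forall s, s != finset.set0 -> dim G (meet_of E s) = gdim N (common N s)) ->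
  Delta G E = (#|` [fset x in vertices N | [exists i, x \in F i]]%fset|)%:Z -
    \sum_(Y <- flats N | [exists i, (Y `<=` F i)%fset]) alpha N Y.
Proof.
move=> fin cF dimE'; apply: Delta_eq => s s0.
rewrite -/(meet_of E s) dimE' //; have cs := closed_common fin cF s0.
have := alpha_sum fin cs; rewrite -cardfs_sum -/(common N s).
have -> : \sum_(Y <- flats N | (Y `<=` common N s)%fset) alpha N Y =
    \sum_(Y <- flats N | [forall i in s, (Y `<=` F i)%fset]) alpha N Y.
  rewrite big_seq_cond [RHS]big_seq_cond; apply: eq_bigl => Y.
  case YN: (Y \in flats N) => //=; have /(in_flats _ fin)[YV _] := YN.
  apply/fsubsetP/forall_inP => [YF i si|YF x xY].
    by apply/fsubsetP => x /YF; rewrite !inE /= => /andP[_ /forall_inP]; apply.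
  rewrite !inE /= (fsubsetP (sub_vertices fin YV) x xY) /=.
  by apply/forall_inP => i /YF /fsubsetP; apply.
by move=> ->; rewrite opprB addrC subrK.
Qed.

End FlatFamily.

(** Apply the inequality of alternating sums to the closures of all the flats of
    [K] of dimension at most [i].  Their traces on [H] are flats of dimension at
    most [i], and every such flat of [H] arises. *)
Lemma sqsub_rho_upto H K G i :
  subpregeometry H K -> subpregeometry K G -> finite_set (ground K) ->
  meet_embedded K G -> sqsub H G ->
  rho_upto K i - rho_upto H i <=
    (#|` vertices K|%N)%:Z - (#|` vertices H|%N)%:Z.
Proof.
move=> HK KG finK meet sq; have HG := subpregeometry_trans HK KG.
have finH : finite_set (ground H) := sub_finite_set HK.1 finK.
pose low := [seq X <- flats K | gdim K X <= i]%N.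
pose F (j : 'I_(size low)) := tnth (in_tuple low) j.
have lowP X : reflect (closed K [set` X] /\ (gdim K X <= i)%N) (X \in low).
  rewrite mem_filter; apply: (iffP andP) => -[].
    by move=> dX /(in_flats _ finK) cX.
  by move=> cX dX; split=> //; apply/in_flats.
have Flow j : F j \in low by apply: mem_tnth.
have cF j : closed K [set` F j] by case/lowP: (Flow j).
have FK j : [set` F j] `<=` ground K by case: (cF j).
have FG j : [set` F j] `<=` ground G := subset_trans (@FK j) KG.1.
have lowF X : X \in low -> exists j, F j = X.
  move=> Xl; have /tnthP[j ->] : X \in in_tuple low by [].
  by exists j.
pose E j := cl G [set` F j].
have cE j : closed G (E j) by apply: closed_cl.
have EK j : E j `&` ground K = [set` F j] by apply: closed_subE.
have cFK j : closed K ([set` F j] `&` ground K).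
  by rewrite -EK -setIA classical_sets.setIid; apply: (closed_trace KG).
have cFH j : closed H ([set` F j] `&` ground H).
  by rewrite -EK -setIA (classical_sets.setIidr HK.1); apply: (closed_trace HG).
have := sq _ E; have -> : (forall j, closed G (E j) /\ finite_dim G (E j)) <-> True.
  by split=> // _ j; split=> //; exists (dim K [set` F j]); apply: dim_cl_closed.
move=> /(_ Logic.I).
have KV : [set` vertices K] = ground K by apply: ground_vertices.
have HV : [set` vertices H] = ground H by apply: ground_vertices.
rewrite (Delta_flats (F := F) (N := K) (G := G)) //; last first.
  move=> s s0; apply: dimE; set A := common F K s.
  have cA : closed K [set` A] by apply: closed_common.
  have AK := cA.1; have AG := subset_trans AK KG.1.
  rewrite KG.2 //; apply: is_dim_between => //.
    move=> x /=; rewrite !inE /= => /andP[xK /forall_inP xF] j sj.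
    by apply: sub_cl; [exact: FG|exact: xF].
  move=> x xE; have xcl : [set x] `<=` cl G (ground K).
    move=> _ ->; have /finset.set0Pn[j sj] := s0.
    by apply: cl_mono (xE j sj); apply: FK.
  have [B [cB hull]] := hull_exists finK meet xcl.
  have BA : (B `<=` A)%fset.
    apply/fsubsetP => y yB; rewrite !inE /=; apply/andP; split.
      by have := cB.1 y yB; rewrite -KV.
    apply/forall_inP => j sj; apply: (fsubsetP _ y yB).
    by apply/(hull _ (cF j)) => _ ->; apply: xE.
  suff : cl G [set` B] x by apply: cl_mono => y; apply: (fsubsetP BA).
  by apply: ((hull B cB).2 (fsubset_refl B)).
rewrite (Delta_flats (F := F) (N := H) (G := H)) //; last first.
  move=> s s0; apply: dimE; set A := common F H s.
  have cA : closed H [set` A] by apply: closed_common.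
  suff -> : meet_of (fun j => E j `&` ground H) s = [set` A] by apply: is_dim_fset; case: cA.
  apply/seteqP; split=> x; last first.
    rewrite /= !inE /= => /andP[xH /forall_inP xF] j sj; split; last by rewrite -HV.
    by apply: sub_cl; [exact: FG|exact: xF].
  move=> xE; rewrite /= !inE /=; apply/andP; split.
    by have /finset.set0Pn[j sj] := s0; have [_] := xE j sj; rewrite -HV.
  apply/forall_inP => j sj; have [xEj xH] := xE j sj.
  suff : [set` F j] x by [].
  by rewrite -EK; split=> //; apply: HK.1.
have -> : \sum_(Y <- flats K | [exists j, (Y `<=` F j)%fset]) alpha K Y = rho_upto K i.
  rewrite /rho_upto big_seq_cond [RHS]big_seq_cond; apply: eq_bigl => Y.
  case YK: (Y \in flats K) => //=; apply/existsP/idP => [[j YF]|dY].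
    have /lowP[_] := Flow j; apply: leq_trans; exact: gdim_mono.
  have /lowF[j eF] : Y \in low by apply/lowP; split=> //; apply/in_flats.
  by exists j; rewrite eF.
have -> : \sum_(Y <- flats H | [exists j, (Y `<=` F j)%fset]) alpha H Y = rho_upto H i.
  rewrite /rho_upto big_seq_cond [RHS]big_seq_cond; apply: eq_bigl => Y.
  case YH: (Y \in flats H) => //=; have /(in_flats _ finH) cY := YH.
  have YK := closed_ground_sub HK cY.
  rewrite HK.2; last by case: cY.
  apply/existsP/idP => [[j YF]|dY].
    have /lowP[_] := Flow j; apply: leq_trans; exact: gdim_mono.
  have [B eB] := finite_closed finK (closed_cl YK).
  have YB : (Y `<=` B)%fset.
    by apply/fsubsetP => y yY; suff : [set` B] y by []; rewrite -eB; apply: sub_cl.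
  have /lowF[j eF] : B \in low.
    apply/lowP; rewrite -eB; split; first exact: closed_cl.
    apply: leq_trans dY; apply: gdim_in_cl => //.
    by rewrite -eB.
  by exists j; rewrite eF.
set UK := [fset x in vertices K | _]%fset; set UH := [fset x in vertices H | _]%fset.
have VHK : (vertices H `<=` vertices K)%fset.
  by apply: sub_vertices => //; rewrite HV; apply: HK.1.
have sub : (UK `\` UH `<=` vertices K `\` vertices H)%fset.
  apply/fsubsetP => x; rewrite !inE /=; case/andP=> nH /andP[xK xF].
  by rewrite xK andbT; apply: contra nH => xH; rewrite xH.
have UHK : (UH `<=` UK)%fset.
  by apply/fsubsetP => x; rewrite !inE /= => /andP[/(fsubsetP VHK) ->].
have := fsubset_leq_card sub; rewrite !cardfsDS //.
have := fsubset_leq_card VHK; have := fsubset_leq_card UHK; lia.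
Qed.

Lemma sqsub_rank_le H G : subpregeometry H G -> sqsub H G -> rank_le H G.
Proof.
move=> HG sq K finK HK KG star.
have meet := (sqsub_starP KG finK).1 star.
have finH : finite_set (ground H) := sub_finite_set HK.1 finK.
have VHK : (vertices H `<=` vertices K)%fset.
  by apply: sub_vertices => //; rewrite ground_vertices //; apply: HK.1.
have dle : (gdim H (vertices H) <= gdim K (vertices K))%N.
  by rewrite HK.2 ?ground_vertices //; apply: gdim_mono; rewrite ?ground_vertices.
have [deq|dne] := eqVneq (gdim H (vertices H)) (gdim K (vertices K)); last first.
  by right; exists None; split=> //; rewrite !rho_top; lia.
apply: (@omod_le_tails M H K (#|` vertices K| - #|` vertices H|)) => //.
  by rewrite subnKC // fsubset_leq_card.
move=> i; have := sqsub_rho_upto i HK KG finK meet sq.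
have := fsubset_leq_card VHK; lia.
Qed.

End SqsubRank.

(** * Making a subgeometry self-sufficient *)

Section Passage.
Variables (M I : choiceType).
Implicit Types (G H K : pregeometry M) (A B X Y Z P : {fset M}) (C : set M).
Implicit Types (R : set I) (f g : I -> {fset M}).

Lemma sub_represents R f G H P : represents R f G -> subpregeometry H G ->
  ground H = [set` P] -> tight R f G P -> represents (edges_of R f P) f H.
Proof.
move=> rep HG eP tP; have [fV bound _] := rep.
have PV : [set` P] `<=` ground G by rewrite -eP; apply: HG.1.
split=> [e [Re fP]|Y S YP SY|X XP].
- by rewrite eP; apply: fsub_set fP _.
- rewrite HG.2 //; apply: bound; first by rewrite eP in YP; apply: subset_trans YP PV.
  by move=> e /SY [[]].
have XPf : (X `<=` P)%fset by apply/fsubsetP => x /XP; rewrite eP.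
have XV := subset_trans XP HG.1.
have TP := @trace_sub _ P (cl G [set` X]); have TV := fsub_set TP PV.
exists (trace P (cl G [set` X])), (edges_within R f (trace P (cl G [set` X]))).
split; first exact: sub_trace_cl.
- by rewrite eP; apply: fsub_set TP _.
- move=> e /(edges_withinP rep TV)[Re fT]; split=> //; split=> //.
  exact: fsubset_trans fT TP.
have := tight_trace rep PV tP (closed_cl XV).
by rewrite /tight gdim_trace_cl // HG.2.
Qed.

(** A self-sufficient part is itself embedded in [G] by [tight_sqsub], so
    everything embedded in it is embedded in [G]. *)
Lemma restr_inherits R f G H P : represents R f G -> [set` P] `<=` ground G ->
  tight R f G P -> subpregeometry H G -> ground H `<=` [set` P] ->
  meet_embedded H G -> rank_le H G ->
  [/\ subpregeometry H (restr G [set` P]), meet_embedded H (restr G [set` P]) &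
      rank_le H (restr G [set` P])].
Proof.
move=> rep PV tP HG HP meet rank; have eP := ground_restr PV.
have PG := restr_sub G [set` P].
have HPG : subpregeometry H (restr G [set` P]).
  by split; [rewrite eP|move=> A AH; rewrite HG.2].
have finP : finite_set (ground (restr G [set` P])) by rewrite eP; apply: finite_fset.
have meetP : meet_embedded (restr G [set` P]) G.
  by apply: sqsub_meet_embedded => //; apply: tight_sqsub rep PG eP tP.
split=> //; first exact: meet_embedded_restr HPG PG meet.
move=> K finK HK KP star; have KG := subpregeometry_trans KP PG.
apply: rank => //; apply/(sqsub_starP KG finK).
by apply: (meet_embedded_trans KP PG _ meetP); apply/(sqsub_starP KP finK).
Qed.

End Passage.

Lemma in_fset_sep (T : choiceType) (A : {fset T}) (Q : pred T) x :
  (x \in [fset y in A | Q y]%fset) = (x \in A) && Q x.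
Proof. by rewrite !inE. Qed.

Section Hull.
Variables (M I : choiceType).
Implicit Types (A B X Y Z P T : {fset M}) (C : set M).

Definition is_hull (H G : pregeometry M) (hull : {fset M} -> {fset M}) : Prop :=
  forall T, [set` T] `<=` ground G -> closed H [set` hull T] /\
    forall B, closed H [set` B] ->
      ([set` T] `<=` cl G [set` B] <-> (hull T `<=` B)%fset).

Local Open Scope ring_scope.

Lemma sum_fibers (T : choiceType) (S : {fset T}) (h : T -> {fset M})
    (D : {fset {fset M}}) (Q : pred {fset M}) :
  (forall t, t \in S -> h t \in D) ->
  \sum_(Y <- D | Q Y) (#|` [fset t in S | h t == Y]%fset|)%:Z =
  (#|` [fset t in S | Q (h t)]%fset|)%:Z.
Proof.
move=> hD; rewrite cardfs_sum.
under eq_bigr do rewrite cardfs_sum big_mkcond.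
rewrite exchange_big /= [RHS]big_mkcond; apply: eq_fbigr => t tS _.
rewrite -big_mkcondr /= -big_filter; case Qt: (Q (h t)).
  rewrite (_ : [seq _ <- _ | _] = [:: h t]) ?big_seq1 //.
  rewrite (eq_filter (a2 := pred1 (h t))); last first.
    by move=> Y /=; rewrite eq_sym; case: eqP => [->|]; rewrite ?Qt ?andbF.
  by apply: filter_pred1_uniq; [apply: fset_uniq|apply: hD].
rewrite big_filter big1 // => Y /andP[QY /eqP e].
by rewrite e QY in Qt.
Qed.

Section HullRank.
Variables (R : set I) (f : I -> {fset M}) (H G : pregeometry M).
Variable hull : {fset M} -> {fset M}.
Hypotheses (rep : represents R f G) (finG : finite_set (ground G)).
Hypotheses (HG : subpregeometry H G) (hullP : is_hull H G hull).
Local Notation V := (vertices G).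
Local Notation E := (edges_within R f V).
Local Notation N := (vertices G `\` vertices H)%fset.

Let finH : finite_set (ground H) := sub_finite_set HG.1 finG.
Let VG : [set` V] `<=` ground G.
Proof. by rewrite ground_vertices. Qed.
Let fG e : e \in E -> [set` f e] `<=` ground G.
Proof. by case: rep => fV _ _ /(edges_withinP rep VG)[Re _]; apply: fV. Qed.
Let pG p : p \in N -> [set` [fset p]%fset] `<=` ground G.
Proof. by case/fsetDP=> pV _ x /=; rewrite inE => /eqP->; apply: VG. Qed.

(** By Moebius inversion it suffices to sum over the flats of [H] within [X].
    The edges with hull within [X] are those in the closure [C] of [X], as many as
    the nullity of [C]; the new points with hull within [X] are those of [C].  The
    difference is the nullity of [X]. *)
Lemma alpha_hull X : closed H [set` X] ->
  alpha H X = (#|` [fset e in E | hull (f e) == X]%fset|)%:Z -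
              (#|` [fset p in N | hull [fset p]%fset == X]%fset|)%:Z.
Proof.
pose w X := (#|` [fset e in E | hull (f e) == X]%fset|)%:Z -
            (#|` [fset p in N | hull [fset p]%fset == X]%fset|)%:Z : int.
apply: (alpha_unique (w := w)) => // {}X cX; rewrite /w sumrB !sum_fibers.
- have XH := cX.1; have XG := subset_trans XH HG.1.
  have XV := sub_vertices finG XG.
  pose C := trace V (cl G [set` X]).
  have CV : (C `<=` V)%fset := @trace_sub _ _ _.
  have tC : tight R f G C.
    apply: (tight_trace rep VG); last exact: closed_cl.
    by apply: (ground_tight rep); rewrite ground_vertices.
  have dC : gdim G C = gdim G X by apply: gdim_trace_cl.
  have CG : [set` C] `<=` ground G by apply: fsub_set CV VG.
  have -> : [fset e in E | (hull (f e) `<=` X)%fset]%fset = edges_within R f C.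
    apply/fsetP => e; rewrite !inE /=; apply/andP/(edges_withinP rep CG).
      case=> eE hX; have [Re fV] := edges_withinP rep VG eE; split=> //.
      by apply: traceS => //; apply/(hullP (fG eE)).2.
    case=> Re fC; have eE : e \in E.
      by apply/(edges_withinP rep VG); split=> //; apply: fsubset_trans fC CV.
    split=> //; apply/(hullP (fG eE)).2 => // x /(fsubsetP fC).
    by move/traceP => [].
  have -> : [fset p in N | (hull [fset p] `<=` X)%fset]%fset = (C `\` X)%fset.
    apply/fsetP => p; rewrite [RHS]in_fsetD in_trace in_fset_sep.
    have Hp : p \in C -> (p \in vertices H) = (p \in X).
      move=> /traceP[_ pcl]; have : (cl G [set` X] `&` ground H) p <-> [set` X] p.
        by rewrite (closed_subE HG cX).
      rewrite -(ground_vertices finH) /= => -[h1 h2].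
      by apply/idP/idP => [pH|/h2[]//]; apply: h1.
    apply/andP/andP => [[pN hX]|[pX /andP[pV /asboolP pcl]]].
      have pcl : cl G [set` X] p.
        by have /(hullP (pG pN)).2 := hX; apply=> //=; rewrite inE.
      case/fsetDP: pN => pV pH; have pC : p \in C by apply/traceP.
      by rewrite -Hp // pH pV; split=> //; apply/asboolP.
    have pC : p \in C by apply/traceP.
    have pN : p \in N by rewrite in_fsetD pV Hp // pX.
    split=> //; apply/(hullP (pG pN)).2 => // x /=.
    by rewrite inE => /eqP->.
  have XC : (X `<=` C)%fset by apply: sub_trace_cl.
  have := fsubset_leq_card XC; rewrite cardfsDS // HG.2 //.
  rewrite /tight dC in tC; lia.
- by move=> p pN; apply/(in_flats _ finH); case: (hullP (pG pN)).
- by move=> e eE; apply/(in_flats _ finH); case: (hullP (fG eE)).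
Qed.

Lemma rho_coef_hull j : rho_coef H j =
  (#|` [fset e in E | gdim G (hull (f e)) == j]%fset|)%:Z -
  (#|` [fset p in N | gdim G (hull [fset p]%fset) == j]%fset|)%:Z.
Proof.
rewrite /rho_coef.
have -> : \sum_(X <- flats H | gdim H X == j) alpha H X =
    \sum_(X <- flats H | gdim G X == j)
      ((#|` [fset e in E | hull (f e) == X]%fset|)%:Z -
       (#|` [fset p in N | hull [fset p]%fset == X]%fset|)%:Z).
  rewrite big_seq_cond [RHS]big_seq_cond; apply: eq_big => X.
    case XF: (X \in flats H) => //=; have /(in_flats _ finH) [XH _] := XF.
    by rewrite HG.2.
  by case/andP=> /(in_flats _ finH) cX _; apply: alpha_hull.
rewrite sumrB !sum_fibers // => t tS; apply/(in_flats _ finH).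
  by case: (hullP (pG tS)).
by case: (hullP (fG tS)).
Qed.

End HullRank.

Lemma closure_is_hull (G : pregeometry M) : finite_set (ground G) ->
  is_hull G G (fun T => trace (vertices G) (cl G [set` T])).
Proof.
move=> finG T TG; have eV := ground_vertices finG.
have eT : [set` trace (vertices G) (cl G [set` T])] = cl G [set` T].
  apply/seteqP; split; first exact: trace_subset.
  by move=> x xcl; apply/traceP; split=> //; have := cl_ground xcl; rewrite -eV.
split; first by rewrite eT; apply: closed_cl.
move=> B cB; split=> [TB|TB].
  apply/fsubsetP => x xT; have : cl G [set` T] x by rewrite -eT.
  move=> /(cl_mono TB); rewrite cB.2 cB.2; exact.
rewrite cB.2 => x xT; apply: (fsubsetP TB); apply/traceP.
by split; [have := TG x xT; rewrite -eV|apply: sub_cl].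
Qed.

End Hull.

Section Extension.
Variables (M I : choiceType).
Implicit Types (A B X Y Z P T : {fset M}) (C : set M).

Lemma minimal_fset A (Q : {fset M} -> bool) : Q A ->
  exists B, [/\ (B `<=` A)%fset, Q B & forall Z, (Z `<` B)%fset -> ~~ Q Z].
Proof.
have [n] := ubnP #|` A|; elim: n A => // n IH A ltA QA.
have [[Z [ZA QZ]]|no] := pselect (exists Z, (Z `<` A)%fset /\ Q Z).
  have [|B [BZ QB minB]] := IH Z _ QZ; first exact: leq_trans (fproper_ltn_card ZA) _.
  by exists B; split=> //; apply: fsubset_trans BZ (fproper_sub ZA).
exists A; split; [exact: fsubset_refl|by []|move=> Z ZA].
by apply/negP => QZ; apply: no; exists Z.
Qed.

Section OneStep.
Variables (R : set I) (f : I -> {fset M}) (H G : pregeometry M).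
Variable hull : {fset M} -> {fset M}.
Hypotheses (rep : represents R f G) (finG : finite_set (ground G)).
Hypotheses (HG : subpregeometry H G) (hullP : is_hull H G hull).
Hypothesis full : gdim G (vertices H) = gdim G (vertices G).
Local Notation V := (vertices G).
Local Notation d := (gdim G).
Local Notation E := (edges_within R f V).
Local Notation N := (vertices G `\` vertices H)%fset.
Local Notation C e := (trace V (cl G [set` f e])).

Let finH : finite_set (ground H) := sub_finite_set HG.1 finG.
Let eV : [set` V] = ground G := ground_vertices finG.
Let eH : [set` vertices H] = ground H := ground_vertices finH.
Let VG : [set` V] `<=` ground G.
Proof. by rewrite eV. Qed.
Let tV : tight R f G V.
Proof. by apply: (ground_tight rep); rewrite eV. Qed.
Let EP e : reflect (R e) (e \in E).
Proof.
have [fV _ _] := rep; apply: (iffP (edges_withinP rep VG)) => [[]//|Re].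
by split=> //; apply/fsubsetP => x /(fV e Re); rewrite -eV.
Qed.
Let fG e : e \in E -> [set` f e] `<=` ground G.
Proof. by case: rep => fV _ _ /EP; apply: fV. Qed.
Let oneG p : p \in V -> [set` [fset p]%fset] `<=` ground G.
Proof. by move=> pV x /=; rewrite inE => /eqP->; apply: VG. Qed.
Let NV p : p \in N -> p \in V.
Proof. by case/fsetDP. Qed.

(** The edges whose closure is not the closure of a flat of [H]: they contribute
    to different coefficients in [rho H] and [rho G]. *)
Definition spread : {fset I} := [fset e in E | d (f e) < d (hull (f e))]%fset.

Let inSpread e : (e \in spread) = (e \in E) && (d (f e) < d (hull (f e))).
Proof. exact: in_fset_sep. Qed.

Let hullG T : [set` T] `<=` ground G -> [set` hull T] `<=` ground G.
Proof. by case/hullP => -[TH _] _; apply: subset_trans TH HG.1. Qed.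

Lemma hull_cl T : [set` T] `<=` ground G -> [set` T] `<=` cl G [set` hull T].
Proof. by move=> TG; have [cT hT] := hullP TG; apply/hT. Qed.

Lemma gdim_hull T : [set` T] `<=` ground G -> d T <= d (hull T).
Proof. by move=> TG; apply: gdim_in_cl; [apply: hullG|apply: hull_cl]. Qed.

Lemma hull_point T p : [set` T] `<=` ground G ->
  p \in trace V (cl G [set` T]) -> (hull [fset p] `<=` hull T)%fset.
Proof.
move=> TG /traceP[pV pcl]; have [cT _] := hullP TG.
apply/((hullP (oneG pV)).2 _ cT) => x /=; rewrite inE => /eqP->.
move: pcl; apply: closed_sub; last exact: hull_cl.
by apply: closed_cl; apply: hullG.
Qed.

Lemma cl_hull_tightly T : [set` T] `<=` ground G -> d (hull T) <= d T ->
  [set` hull T] `<=` cl G [set` T].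
Proof.
move=> TG le; have hG := hullG TG; have UG := fsetU_set TG hG.
have dU : d (T `|` hull T)%fset <= d (hull T).
  apply: gdim_in_cl => //; apply: fsetU_set; first exact: hull_cl.
  exact: sub_cl.
have eU : d T = d (T `|` hull T)%fset.
  have := gdim_mono (fsubsetUl T (hull T)) UG; lia.
move=> x xh; apply: (cl_full (fsubsetUl T (hull T)) UG eU).
by rewrite /= in_fsetU xh orbT.
Qed.

(** Above [i] the coefficients of [rho H] and [rho G] agree.  At [i], that of
    [rho H] counts in addition the spread edges minus the new points, while a
    spread edge of dimension [i] would have a hull of larger dimension. *)
Lemma spread_le_points i : sqsub_star G G -> rank_le H G ->
  (forall p, p \in N -> d (hull [fset p]%fset) <= i) ->
  (forall e, e \in spread -> d (hull (f e)) <= i) ->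
  #|` [fset e in spread | d (hull (f e)) == i]%fset| <=
  #|` [fset p in N | d (hull [fset p]%fset) == i]%fset|.
Proof.
move=> starG rank Ni Si.
have coefH j := rho_coef_hull rep finG HG hullP j.
have coefG j := rho_coef_hull rep finG (subpregeometry_refl G) (closure_is_hull finG) j.
have count j : i <= j -> #|` [fset e in E | d (hull (f e)) == j]%fset| =
    #|` [fset e in E | d (C e) == j]%fset| +
    #|` [fset e in spread | d (hull (f e)) == j]%fset|.
  move=> ij; rewrite -(cardfsID [fset e in E | d (C e) == j]%fset); congr (_ + _).
    congr #|` _|; apply/fsetP => e; rewrite in_fsetI !in_fset_sep.
    case eE: (e \in E) => //=; rewrite (gdim_trace_cl (A := f e)) //; last first.
      by apply: sub_vertices => //; apply: fG.
    case: (d (f e) =P j) => [dj|]; rewrite ?andbF // andbT.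
    have := gdim_hull (fG eE); rewrite dj leq_eqVlt => /orP[/eqP->|lt]; first by rewrite eqxx.
    have : e \in spread by rewrite inSpread eE dj.
    by move=> /Si; lia.
  congr #|` _|; apply/fsetP => e; rewrite in_fsetD !in_fset_sep.
  case eE: (e \in E) => //=; rewrite (gdim_trace_cl (A := f e)) //; last first.
    by apply: sub_vertices => //; apply: fG.
  case: (d (hull (f e)) =P j) => [dj|]; rewrite ?andbF // !andbT.
  by have := gdim_hull (fG eE); rewrite dj; lia.
have diff j : i <= j -> (rho_coef H j = rho_coef G j +
    (#|` [fset e in spread | d (hull (f e)) == j]%fset|)%:Z -
    (#|` [fset p in N | d (hull [fset p]%fset) == j]%fset|)%:Z)%R.
  move=> ij; rewrite coefH coefG count //.
  set n0 := #|` [fset p in (V `\` V)%fset | _]%fset|.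
  have -> : n0 = 0.
    by apply/eqP; rewrite cardfs_eq0; apply/eqP/fsetP => p; rewrite !inE andNb.
  lia.
have zero j : i < j -> rho_coef H j = rho_coef G j.
  move=> ij; rewrite diff; last exact: ltnW.
  have -> : [fset e in spread | d (hull (f e)) == j]%fset = fset0.
    apply/fsetP => e; rewrite in_fset_sep in_fset0; apply/negP => /andP[/Si le /eqP].
    lia.
  have -> : [fset p in N | d (hull [fset p]%fset) == j]%fset = fset0.
    apply/fsetP => e; rewrite in_fset_sep in_fset0; apply/negP => /andP[/Ni le /eqP].
    lia.
  by rewrite !cardfs0; lia.
have le : (rho_coef H i <= rho_coef G i)%R.
  have := rank G finG HG (subpregeometry_refl G) starG.
  case=> [e|[[j|]]]; first by rewrite -!rhoE e.
    rewrite !rhoE => -[lt above]; have [ij|ji] := ltnP i j.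
      by move: lt; rewrite zero // ltxx.
    move: ji; rewrite leq_eqVlt => /orP[/eqP<-|ji]; first exact: ltW.
    by have := above (Some i) ji; rewrite !rhoE => ->.
  by rewrite !rho_top HG.2 ?eH // full => -[]; rewrite ltxx.
by move: le; rewrite diff //; lia.
Qed.

(** The points to be removed are new points whose hull has the largest possible
    dimension, in a minimal nonempty set that meets at most as many spread edges
    as it has points; minimality is Hall's condition.  A spread edge through such
    a point has the same hull as the point, since both hulls have the same
    dimension, whereas an edge that is not spread contains the hull in its
    closure. *)
Lemma peelable : sqsub_star G G -> rank_le H G -> N != fset0 ->
  exists (N1 : {fset M}) (L : {fset I}),
  [/\ (N1 `<=` N)%fset, N1 != fset0, #|` L| = #|` N1|, forall e, e \in L -> R e &
   [/\ forall Z, (Z `<=` N1)%fset ->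
        #|` Z| <= #|` [fset e in L | (C e `&` Z != fset0)%fset]%fset|,
      forall e p, e \in L -> p \in N1 -> p \in C e ->
        (C e `<=` trace V (cl G [set` hull [fset p]%fset]))%fset &
      forall e p, R e -> e \notin L -> p \in N1 -> p \in C e ->
        (trace V (cl G [set` hull [fset p]%fset]) `<=` C e)%fset]].
Proof.
move=> starG rank /fset0Pn[p0 p0N].
(* The largest dimension at which [rho H] and [rho G] can differ. *)
pose Q i := `[< (exists2 p, p \in N & d (hull [fset p]%fset) = i) \/
                (exists2 e, e \in spread & d (hull (f e)) = i) >].
have exQ : exists i, Q i.
  by exists (d (hull [fset p0]%fset)); apply/asboolP; left; exists p0.
have dV T : [set` T] `<=` ground G -> d T <= d V.
  by move=> TG; apply: gdim_mono => //; apply: sub_vertices.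
have spreadE e : e \in spread -> e \in E by rewrite inSpread => /andP[].
have ubQ i : Q i -> i <= d V.
  move=> /asboolP[[p pN <-]|[e eS <-]]; apply: dV; apply: hullG.
    exact: oneG (NV pN).
  exact: fG (spreadE e eS).
have [i /asboolP Qi maxi] := ex_maxnP exQ ubQ.
have Ni p : p \in N -> d (hull [fset p]%fset) <= i.
  by move=> pN; apply: maxi; apply/asboolP; left; exists p.
have Si e : e \in spread -> d (hull (f e)) <= i.
  by move=> eS; apply: maxi; apply/asboolP; right; exists e.
pose P := [fset p in N | d (hull [fset p]%fset) == i]%fset.
pose S := [fset e in spread | d (hull (f e)) == i]%fset.
have inS e : (e \in S) = (e \in spread) && (d (hull (f e)) == i) by exact: in_fset_sep.
have PP p : reflect (p \in N /\ d (hull [fset p]%fset) = i) (p \in P).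
  by rewrite in_fset_sep; apply: (iffP andP) => -[pN /eqP].
have leSP : #|` S| <= #|` P| := spread_le_points starG rank Ni Si.
have P0 : P != fset0.
  rewrite -cardfs_gt0; case: Qi => [[p pN dp]|[e eS de]].
    by rewrite cardfs_gt0; apply/fset0Pn; exists p; apply/PP.
  apply: leq_trans leSP; rewrite cardfs_gt0; apply/fset0Pn; exists e.
  by rewrite inS eS de eqxx.
pose Gam Z := [fset e in spread | (C e `&` Z != fset0)%fset]%fset.
have inGam Z e : (e \in Gam Z) = (e \in spread) && (C e `&` Z != fset0)%fset.
  exact: in_fset_sep.
have hullE e p : e \in spread -> p \in P -> p \in C e ->
    hull [fset p]%fset = hull (f e).
  move=> eS /PP[pN dp] pC; have eE := spreadE e eS.
  have sub := hull_point (fG eE) pC; apply/eqP; rewrite eqEfsubset sub /=.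
  have [cp _] := hullP (oneG (NV pN)); have [ce _] := hullP (fG eE).
  have deq : d (hull [fset p]%fset) = d (hull (f e)).
    have := gdim_mono sub (hullG (fG eE)); rewrite dp.
    by have := Si e eS; lia.
  apply/fsubsetP => x xh.
  suff : [set` hull [fset p]%fset] x by [].
  rewrite -(closed_subE HG cp); split; last by apply: ce.1.
  exact: (cl_full sub (hullG (fG eE)) deq).
have GamS Z : (Z `<=` P)%fset -> (Gam Z `<=` S)%fset.
  move=> ZP; apply/fsubsetP => e; rewrite inGam inS.
  case/andP=> eS /fset0Pn[p /fsetIP[pC /(fsubsetP ZP) pP]]; rewrite eS /=.
  by rewrite -(hullE e p) //; case/PP: pP => _ ->.
have outer e p : e \in E -> e \notin spread -> p \in C e ->
    (trace V (cl G [set` hull [fset p]%fset]) `<=` C e)%fset.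
  move=> eE nS pC; have sub := hull_point (fG eE) pC.
  have le : d (hull (f e)) <= d (f e) by move: nS; rewrite inSpread eE -leqNgt.
  apply: traceS; first exact: trace_sub.
  apply: subset_trans (@trace_subset _ _ _) _; apply: closed_sub.
    by apply: closed_cl; apply: fG.
  move=> x xh; apply: (cl_hull_tightly (fG eE) le).
  exact: (fsubsetP sub).
have innerS e p : e \in spread -> p \in P -> p \in C e ->
    (C e `<=` trace V (cl G [set` hull [fset p]%fset]))%fset.
  move=> eS pP pC; have eE := spreadE e eS; rewrite (hullE e p) //.
  apply: traceS; first exact: trace_sub.
  apply: subset_trans (@trace_subset _ _ _) _; apply: closed_sub.
    by apply: closed_cl; apply: hullG; apply: fG.
  by apply: hull_cl; apply: fG.
have PN : (P `<=` N)%fset by apply: fset_sub.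
(* A point on no spread edge is removed together with an edge that spans the
   closure of its hull: there is one through the point, as the removal of the
   point from this closure does not lower the dimension. *)
have [[p [pP Gam0]]|noempty] := pselect (exists p, p \in P /\ Gam [fset p]%fset = fset0).
  have /PP[pN dp] := pP; have pV := NV pN; have pG := oneG pV.
  have [cp _] := hullP pG; have hG := hullG pG.
  pose K := trace V (cl G [set` hull [fset p]%fset]).
  have KG : [set` K] `<=` ground G by apply: fsub_set VG; apply: trace_sub.
  have tK : tight R f G K by apply: (tight_trace rep VG tV); apply: closed_cl.
  have pK : p \in K.
    by apply/traceP; split=> //; apply: (hull_cl pG); rewrite /= inE.
  have K1G : [set` (K `\ p)%fset] `<=` ground G := fsub_set (fsubD1set K p) KG.
  have hK : (hull [fset p] `<=` K `\ p)%fset.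
    rewrite fsubsetD1 sub_trace_cl //=; last by apply: sub_vertices.
    case/fsetDP: pN => _; apply: contra => ph.
    by have := cp.1 p ph; rewrite -eH.
  have dK : d (K `\ p)%fset = d K.
    apply/eqP; rewrite eqn_leq gdim_mono ?fsubD1set //=.
    rewrite /K gdim_trace_cl //; first exact: gdim_mono.
    exact: sub_vertices.
  have [e0 e0K e0p] : exists2 e, e \in edges_within R f K & p \in f e.
    apply: contrapT => no.
    have : (edges_within R f K `<=` edges_within R f (K `\ p))%fset.
      apply: (inside_sub rep K1G) => e eK.
      have [Re fK] := edges_withinP rep KG eK; split=> //.
      rewrite fsubsetD1 fK /=; apply/negP => pe; apply: no; by exists e.
    move/fsubset_leq_card; have := edges_within_bound rep K1G.
    by move: tK; rewrite /tight (cardfsD1 p K) pK dK; lia.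
  have [Re0 f0K] := edges_withinP rep KG e0K; have e0E : e0 \in E by apply/EP.
  have pC : p \in C e0.
    by apply: (fsubsetP (sub_trace_cl _ VG)) => //; apply: sub_vertices => //; apply: fG.
  have CeK : (C e0 `<=` K)%fset.
    apply: traceS; first exact: trace_sub.
    apply: subset_trans (@trace_subset _ _ _) _; apply: closed_sub; first exact: closed_cl.
    by move=> x /(fsubsetP f0K) /traceP[].
  exists [fset p]%fset, [fset e0]%fset; split.
  - by rewrite fsub1set.
  - by apply/fset0Pn; exists p; rewrite inE.
  - by rewrite !cardfs1.
  - by move=> e; rewrite inE => /eqP->.
  split.
  - move=> Z; rewrite fsubset1 => /orP[/eqP->|/eqP->]; last by rewrite cardfs0.
    rewrite cardfs1 cardfs_gt0; apply/fset0Pn; exists e0.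
    rewrite in_fset_sep inE eqxx /=; apply/fset0Pn; exists p.
    by rewrite in_fsetI pC fset11.
  - by move=> e q; rewrite !inE => /eqP-> /eqP->.
  - move=> e q Re _; rewrite inE => /eqP-> qC; apply: outer => //; first exact/EP.
    apply/negP => eS; have : e \in Gam [fset p]%fset; last by rewrite Gam0 inE.
    by rewrite inGam eS; apply/fset0Pn; exists p; rewrite in_fsetI qC fset11.
pose few Z := (Z != fset0) && (#|` Gam Z| <= #|` Z|).
have fewP : few P.
  by rewrite /few P0; apply: leq_trans leSP; apply: fsubset_leq_card; apply: GamS.
have [N1 [N1P /andP[N10 few1] min1]] := minimal_fset fewP.
have GamM Z Z' : (Z `<=` Z')%fset -> (Gam Z `<=` Gam Z')%fset.
  move=> ZZ; apply/fsubsetP => e; rewrite !inGam => /andP[-> /fset0Pn[p /fsetIP[pC pZ]]].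
  by apply/fset0Pn; exists p; rewrite in_fsetI pC (fsubsetP ZZ).
have many Z : (Z `<` N1)%fset -> #|` Z| <= #|` Gam Z|.
  move=> /min1; rewrite negb_and negbK => /orP[/eqP->|]; first by rewrite cardfs0.
  by rewrite -ltnNge; apply: ltnW.
have cardN1 : #|` Gam N1| = #|` N1|.
  apply/eqP; rewrite eqn_leq few1 /=; have /fset0Pn[p pN1] := N10.
  have pp := fproperD1 pN1; have := min1 _ pp; rewrite negb_and negbK.
  have := fsubset_leq_card (GamM _ _ (fproper_sub pp)).
  rewrite (cardfsD1 p N1) pN1 -ltnNge => le /orP[/eqP e0|]; last by lia.
  rewrite e0 cardfs0 addn0 cardfs_gt0; apply/eqP => Gam0; apply: noempty.
  exists p; split; first exact: (fsubsetP N1P).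
  by apply/eqP; rewrite -fsubset0 -Gam0; apply: GamM; rewrite fsub1set.
exists N1, (Gam N1); split=> //.
- exact: fsubset_trans N1P PN.
- by move=> e; rewrite inGam => /andP[/spreadE/EP].
split.
- move=> Z ZN1; have -> : [fset e in Gam N1 | (C e `&` Z != fset0)%fset]%fset = Gam Z.
    apply/fsetP => e; rewrite in_fset_sep !inGam; case: (e \in spread) => //=.
    apply/andP/idP => [[]//|CZ]; split=> //; have /fset0Pn[p /fsetIP[pC pZ]] := CZ.
    by apply/fset0Pn; exists p; rewrite in_fsetI pC (fsubsetP ZN1).
  move: ZN1; rewrite fsubEproper => /orP[/eqP->|/many//]; by rewrite cardN1.
- move=> e p; rewrite inGam => /andP[eS _] pN1; apply: innerS => //.
  exact: (fsubsetP N1P).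
- move=> e p Re eG pN1 pC; apply: outer => //; first exact/EP.
  apply: contra eG => eS; rewrite inGam eS; apply/fset0Pn; exists p.
  by rewrite in_fsetI pC.
Qed.

End OneStep.

End Extension.

Section FiniteStage.
Variables (M I : choiceType).
Implicit Types (A B X Y Z P T : {fset M}) (C : set M).
Implicit Types (R : set I) (f g : I -> {fset M}) (H G : pregeometry M).

Lemma glue_tight R f G P X : represents R f G -> [set` P] `<=` ground G ->
  tight R f G P -> (X `<=` P)%fset ->
  (exists g, represents (edges_of R f P) g (restr G [set` P]) /\
             tight (edges_of R f P) g (restr G [set` P]) X) ->
  exists g, represents R g G /\ tight R g G X.
Proof.
move=> rep PV tP XP [g [repg tX]]; exists (replace_in R f P g); split.
  exact: replace_represents.
exact: replace_tight.
Qed.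

(** By induction on the number of points outside [H]: after the removal of some of
    them the others form with [H] a self-sufficient set, in which [H] becomes
    self-sufficient by induction. *)
Lemma finite_extension R f H G : represents R f G -> finite_set (ground G) ->
  subpregeometry H G -> gdim G (vertices H) = gdim G (vertices G) ->
  meet_embedded H G -> rank_le H G ->
  exists g, represents R g G /\ tight R g G (vertices H).
Proof.
have [n] := ubnP #|` (vertices G `\` vertices H)%fset|.
elim: n R f G => // n IH R f G ltn rep finG HG full meet rank.
have finH : finite_set (ground H) := sub_finite_set HG.1 finG.
have eV := ground_vertices finG; have eH := ground_vertices finH.
have HV : (vertices H `<=` vertices G)%fset.
  by apply: sub_vertices => //; rewrite eH; apply: HG.1.
have VG : [set` vertices G] `<=` ground G by rewrite eV.
have tV : tight R f G (vertices G) by apply: (ground_tight rep); rewrite eV.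
have [N0|N0] := eqVneq (vertices G `\` vertices H)%fset fset0.
  exists f; split=> //; suff -> : vertices H = vertices G by [].
  by apply/eqP; rewrite eqEfsubset HV -fsetD_eq0 N0 eqxx.
have /choice[hull hullP] : forall T, exists A, [set` T] `<=` ground G ->
    closed H [set` A] /\ forall B, closed H [set` B] ->
      ([set` T] `<=` cl G [set` B] <-> (A `<=` B)%fset).
  move=> T; have [TG|] := pselect ([set` T] `<=` ground G); last by exists fset0.
  have Tcl : [set` T] `<=` cl G (ground H).
    by rewrite -eH => x /TG; rewrite -eV; apply: cl_full.
  by have [A AP] := hull_exists finH meet Tcl; exists A.
have starG : sqsub_star G G.
  by apply/(sqsub_starP (subpregeometry_refl G) finG); apply: meet_embedded_refl.
have [N1 [L [N1N N10 cL LR [hall inner outer]]]] :=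
  peelable rep finG HG hullP full starG rank N0.
pose V := vertices G; pose f1 := peel f G V N1 L; pose P := (V `\` N1)%fset.
have N1V : (N1 `<=` V)%fset := fsubset_trans N1N (fsubsetDl _ _).
have nested p q : p \in N1 -> q \in N1 ->
    q \in trace V (cl G [set` hull [fset p]%fset]) ->
    (trace V (cl G [set` hull [fset q]%fset]) `<=`
     trace V (cl G [set` hull [fset p]%fset]))%fset.
  move=> pN qN qK; have one r : r \in N1 -> [set` [fset r]%fset] `<=` ground G.
    by move=> rN x /=; rewrite inE => /eqP->; apply: VG; apply: (fsubsetP N1V).
  have [cp _] := hullP _ (one p pN); have [_ hq] := hullP _ (one q qN).
  have sub : (hull [fset q] `<=` hull [fset p])%fset.
    apply/(hq _ cp) => x /=; rewrite inE => /eqP->.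
    by case/traceP: qK.
  apply: traceS; first exact: trace_sub.
  by apply: subset_trans (@trace_subset _ _ _) _; apply: cl_mono => x /(fsubsetP sub).
have rep1 : represents R f1 G.
  exact: (peel_represents rep (esym eV) LR N1V hall inner outer nested).
have HP : (vertices H `<=` P)%fset.
  apply/fsubsetP => x xH; rewrite in_fsetD (fsubsetP HV) // andbT.
  by apply/negP => /(fsubsetP N1N); rewrite in_fsetD xH.
have PV : [set` P] `<=` ground G by apply: fsub_set VG; apply: fsubsetDl.
have dP : gdim G P = gdim G V.
  apply/eqP; rewrite eqn_leq gdim_mono ?fsubsetDl //= -full.
  exact: gdim_mono.
have tP : tight R f1 G P.
  exact: (peel_tight rep (esym eV) LR N1V hall inner outer nested).
have HP' : ground H `<=` [set` P] by rewrite -eH => x /(fsubsetP HP).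
have [HGP meetP rankP] := restr_inherits rep1 PV tP HG HP' meet rank.
have eP := ground_restr PV.
have finP : finite_set (ground (restr G [set` P])) by rewrite eP; apply: finite_fset.
have vP : vertices (restr G [set` P]) = P by rewrite /vertices eP set_fsetK.
apply: (glue_tight rep1 PV tP HP); apply: (IH _ f1) => //.
- rewrite vP; move: ltn; rewrite ltnS; apply: leq_trans.
  apply: fproper_ltn_card; rewrite fproperE fsetSD ?fsubsetDl //=.
  have /fset0Pn[p pN] := N10; apply/fsubsetPn; exists p.
    exact: (fsubsetP N1N).
  by rewrite !in_fsetD pN !andbF.
- exact: sub_represents rep1 (restr_sub G _) eP tP.
- by rewrite vP /= dP.
Qed.

(** Only a finite self-sufficient set that contains [H] and has the same dimension
    has to be represented anew. *)
Lemma tight_extension R f H G : represents R f G -> finite_set (ground H) ->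
  subpregeometry H G -> meet_embedded H G -> rank_le H G ->
  exists g, represents R g G /\ tight R g G (vertices H).
Proof.
move=> rep finH HG meet rank; have eH := ground_vertices finH.
have HV : [set` vertices H] `<=` ground G by rewrite eH; apply: HG.1.
have [P [HP PV dP tP]] := tight_above rep HV.
have HP' : ground H `<=` [set` P] by rewrite -eH => x /(fsubsetP HP).
have [HGP meetP rankP] := restr_inherits rep PV tP HG HP' meet rank.
have eP := ground_restr PV.
have finP : finite_set (ground (restr G [set` P])) by rewrite eP; apply: finite_fset.
apply: (glue_tight rep PV tP HP); apply: (@finite_extension _ f) => //.
  exact: sub_represents rep (restr_sub G _) eP tP.
by rewrite /vertices eP set_fsetK.
Qed.

Lemma tight_shrink R f g G X : represents R f G -> represents R g G ->
  (forall e, (g e `<=` f e)%fset) -> [set` X] `<=` ground G ->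
  tight R f G X -> tight R g G X.
Proof.
move=> rep repg gf XV tX; have := edges_within_bound repg XV.
have /fsubset_leq_card : (edges_within R f X `<=` edges_within R g X)%fset.
  apply: (inside_sub repg XV) => e /(edges_withinP rep XV)[Re fX].
  by split=> //; apply: fsubset_trans (gf e) fX.
by rewrite /tight in tX *; lia.
Qed.

(** Two equal edges would give an edge of nullity at least two. *)
Lemma good_injective R f G : represents R f G ->
  (forall e, R e -> #|` f e| = (gdim G (f e)).+1) ->
  forall e e', R e -> R e' -> f e = f e' -> e = e'.
Proof.
move=> [fV bound _] good e e' Re Re' eqf; apply: contrapT => /eqP ne.
have := bound (f e) [fset e; e']%fset (fV e Re).
rewrite good // cardfs2 ne addn2 ltnS => le.
suff : (gdim G (f e)).+1 <= gdim G (f e) by rewrite ltnn.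
by apply: le => x; rewrite !inE => /orP[]/eqP->; split=> //; rewrite eqf.
Qed.
End FiniteStage.

(** * Hypergraphs *)

Section Hypergraphs.
Variable M : choiceType.
Implicit Types (A B : hypergraph M) (G H : pregeometry M) (X Y P e : {fset M}).

Lemma edges_in_finite A (Y : {fset M}) : finite_set (edges_in A [set` Y]).
Proof.
apply: (sub_finite_set (B := [set` fpowerset Y])); last exact: finite_fset.
by move=> e [_ eY] /=; rewrite fpowersetE; apply/fsubsetP.
Qed.

Lemma edges_withinE A Y :
  edges_within (edge A) id Y = fset_set (edges_in A [set` Y]).
Proof.
by congr fset_set; apply/seteqP; split=> e [Ae eY]; split=> //; apply/fsubsetP.
Qed.

Lemma deltaE A Y :
  delta A Y = ((#|` Y|%N)%:Z - (#|` edges_within (edge A) id Y|%N)%:Z)%R.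
Proof. by rewrite /delta edges_withinE. Qed.

Lemma representationP A G : vert A = ground G ->
  representation A G <-> represents (edge A) id G.
Proof.
move=> eV; split=> [[_ hdim]|rep]; last first.
  split=> // X XV; rewrite eV in XV *; split.
    have [Y [XY YV dY tY]] := tight_above rep XV; exists Y; split; rewrite ?eV //.
    by rewrite deltaE; rewrite /tight in tY; lia.
  move=> Y XY YV; rewrite eV in YV; rewrite deltaE.
  by have := edges_within_bound rep YV; have := gdim_mono XY YV; lia.
have inP Y e : (e \in edges_within (edge A) id Y) <-> (edge A e /\ (e `<=` Y)%fset).
  rewrite edges_withinE in_fset_set; last exact: edges_in_finite.
  split=> [/set_mem[Ae eY]|[Ae eY]]; first by split=> //; apply/fsubsetP.
  by apply/mem_set; split=> //; apply/fsubsetP.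
split=> [e Ae|Y S YV SY|X XV].
- by rewrite -eV; apply: edge_vert.
- rewrite -eV in YV; have [_ min] := hdim Y YV.
  have := min Y (fsubset_refl Y) YV; rewrite deltaE.
  have : (S `<=` edges_within (edge A) id Y)%fset.
    by apply/fsubsetP => e /SY /inP.
  by move/fsubset_leq_card; lia.
rewrite -eV in XV; have [[Y [XY YV dY]] _] := hdim X XV.
exists Y, (edges_within (edge A) id Y); split; rewrite -?eV //; first by move=> e /inP.
by move: dY; rewrite deltaE; lia.
Qed.

Lemma image_neq0 (I : choiceType) (R : set I) (f : I -> {fset M}) G :
  represents R f G -> forall e, (f @` R) e -> e != fset0.
Proof.
move=> rep _ [e Re <-]; rewrite -cardfs_gt0.
exact: leq_trans (edge_dim rep Re).
Qed.

Lemma image_vert (I : choiceType) (R : set I) (f : I -> {fset M}) G :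
  represents R f G -> forall e, (f @` R) e -> [set` e] `<=` ground G.
Proof. by move=> [fV _ _] _ [e Re <-]; apply: fV. Qed.

Lemma represents_image (I : choiceType) (R : set I) (f : I -> {fset M}) G :
  represents R f G ->
  (forall i, R i -> #|` f i| = (gdim G (f i)).+1) ->
  represents (f @` R) id G /\
  forall X, [set` X] `<=` ground G -> tight R f G X -> tight (f @` R) id G X.
Proof.
move=> rep good; have inj := good_injective rep good.
have [fV bound attain] := rep.
have imP Y e : [set` Y] `<=` ground G ->
    e \in [fset f i | i in edges_within R f Y]%fset <->
    (f @` R) e /\ (e `<=` Y)%fset.
  move=> YV; split=> [/imfsetP[i /= /(edges_withinP rep YV)[Ri iY] ->]|].
    by split=> //; exists i.
  case=> -[i Ri <-] iY; apply/imfsetP; exists i => //=.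
  exact/(edges_withinP rep YV).
have repI : represents (f @` R) id G.
  split=> [_ [e Re <-]|Y S YV SY|X XV]; first exact: fV.
    have : (S `<=` [fset f i | i in edges_within R f Y])%fset.
      by apply/fsubsetP => e /SY /(imP _ _ YV).
    move/fsubset_leq_card; have := edges_within_bound rep YV.
    have := leq_imfset_card imfset_key f (mem (edges_within R f Y)).
    by move=> /= h1 h2 h3; apply: leq_trans h2; rewrite leq_add2l; apply: (leq_trans h3 h1).
  have [Y [S [XY YV SY cY]]] := attain X XV.
  exists Y, [fset f i | i in S]%fset; split=> //.
    by move=> _ /imfsetP[i /= /SY[Ri iY] ->]; split=> //; exists i.
  by rewrite card_in_imfset // => i j /SY[Ri _] /SY[Rj _]; apply: inj.
split=> // X XV; rewrite /tight => ->; congr (_ + _).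
have -> : edges_within (f @` R) id X = [fset f i | i in edges_within R f X]%fset.
  apply/fsetP => e; apply/(edges_withinP repI XV)/idP => [/(imP _ _ XV)//|].
  by move/(imP _ _ XV).
rewrite card_in_imfset // => i j /(edges_withinP rep XV)[Ri _].
by move=> /(edges_withinP rep XV)[Rj _]; apply: inj.
Qed.

Lemma tight_hyper_le A G (P : {fset M}) (B : hypergraph M) :
  represents (edge A) id G -> vert A = ground G ->
  [set` P] `<=` ground G -> tight (edge A) id G P ->
  vert B = [set` P] -> edge B = edges_in A [set` P] -> hyper_le B A.
Proof.
move=> rep eA PV tP eB eE; rewrite /hyper_le eB eA; split=> // X XV.
have UV := fsetU_set XV PV.
have eU : [set` (X `|` P)%fset] = [set` X] `|` [set` P].
  by apply/seteqP; split=> x /=; [rewrite in_fsetU => /orP|move=> h; rewrite in_fsetU; apply/orP].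
have eN : new_edges A X [set` P] = [set` (edges_within (edge A) id (X `|` P)%fset `\`
    edges_within (edge A) id P)%fset].
  apply/seteqP; split=> e.
    rewrite /new_edges -eU => -[[Ae eXP] nP]; apply/fsetDP; split.
      by apply/(edges_withinP rep UV); split=> //; apply/fsubsetP.
    by apply/negP => /(edges_withinP rep PV)[_ /fsubsetP eP]; apply: nP.
  case/fsetDP=> /(edges_withinP rep UV)[Ae /fsubsetP eXP] nP.
  rewrite /new_edges -eU; split=> // -[_ eP]; move/negP: nP; apply.
  by apply/(edges_withinP rep PV); split=> //; apply/fsubsetP.
have eD : [set` X] `\` [set` P] = [set` (X `\` P)%fset].
  apply/seteqP; split=> x /=; first by case=> xX /negP xP; rewrite in_fsetD xP.
  by rewrite in_fsetD => /andP[/negP].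
split; first by rewrite eN; apply: finite_fset.
rewrite /delta_rel eN eD !set_fsetK.
rewrite (cardfsDS (edges_withinS rep (fsubsetUr X P) UV)).
have := fsubset_leq_card (edges_withinS rep (fsubsetUr X P) UV).
have := edges_within_bound rep UV; have := gdim_mono (fsubsetUr X P) UV.
have := cardfsUI X P; have := cardfsID P X; rewrite /tight in tP; lia.
Qed.

(** Within [H] there is no proper superset of [H], so that the dimension that
    represents [H] is attained by [H] itself. *)
Lemma hyper_le_tight A B G H : vert A = ground G -> finite_set (ground H) ->
  subpregeometry H G -> representation B H -> hyper_le B A ->
  tight (edge A) id G (vertices H).
Proof.
move=> eA finH HG [eB hdim] [_ eE _]; have eH := ground_vertices finH.
have HB : [set` vertices H] `<=` vert B by rewrite eB eH.
have [[Y [HY YB dY]] _] := hdim _ HB.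
have eY : Y = vertices H.
  apply/eqP; rewrite eqEfsubset HY andbT; apply: sub_vertices => //.
  by rewrite -eB.
rewrite eY deltaE HG.2 ?eH // in dY; rewrite /tight.
suff -> : edges_within (edge A) id (vertices H) = edges_within (edge B) id (vertices H) by lia.
rewrite !edges_withinE; congr fset_set; rewrite /edges_in eE eB /edges_in -eH.
by apply/seteqP; split=> e /= [] => [Ae eP|[Ae _] eP].
Qed.

End Hypergraphs.

(** * The three characterizations *)

Theorem corollary2p6p7 (M : choiceType) (G H : pregeometry M)
    (reprG : representable G)
    (subHG : subpregeometry H G) (finH : finite_set (ground H)) :
  (sqsub H G <-> sqsub_star H G /\ rank_le H G) /\
  (sqsub H G <->
     exists A B : hypergraph M,
       [/\ good_representation A G, good_representation B H & hyper_le B A]).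
Proof.
have eH := ground_vertices finH.
have HV : [set` vertices H] `<=` ground G by rewrite eH; apply: subHG.1.
have i12 : sqsub H G -> sqsub_star H G /\ rank_le H G.
  move=> sq; split; last exact: sqsub_rank_le.
  by apply/(sqsub_starP subHG finH); apply: sqsub_meet_embedded.
have i31 : (exists A B : hypergraph M,
    [/\ good_representation A G, good_representation B H & hyper_le B A]) ->
    sqsub H G.
  move=> [A [B [[repA _] [repB _] BA]]]; have eA := repA.1.
  have tH := hyper_le_tight eA finH subHG repB BA.
  exact: tight_sqsub ((representationP eA).1 repA) subHG (esym eH) tH.
have i23 : sqsub_star H G /\ rank_le H G -> exists A B : hypergraph M,
    [/\ good_representation A G, good_representation B H & hyper_le B A].
  case=> /(sqsub_starP subHG finH) meet rank; have [A0 repA0] := reprG.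
  have rep0 := (representationP repA0.1).1 repA0.
  have [f [repf tf]] := tight_extension rep0 finH subHG meet rank.
  have [g [repg gf good]] := good_shrink repf.
  have tg := tight_shrink repf repg gf HV tf.
  have [repI tI] := represents_image repg good; have {}tI := tI _ HV tg.
  pose A := Hypergraph (image_neq0 repg) (image_vert repg).
  have eA : vert A = ground G by [].
  have BV e : edges_in A (ground H) e -> [set` e] `<=` ground H by case.
  have Bn e : edges_in A (ground H) e -> e != fset0 by case=> Ae _; apply: edge_neq0 Ae.
  pose B := Hypergraph Bn BV; have eB : vert B = ground H by [].
  have repA : representation A G by apply/(representationP eA).
  have repB : representation B H.
    apply/(representationP eB); have := sub_represents repI subHG (esym eH) tI.
    suff -> : edges_of (g @` edge A0) id (vertices H) = edge B by [].
    rewrite /= -eH; apply/seteqP; split=> e [Ae eP]; split=> //; exact/fsubsetP.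
  have goodA e : edge A e -> is_hdim A e ((#|` e|%N)%:Z - 1)%R.
    move=> Ae; have := repA.2 e (edge_vert Ae).
    case: (Ae) => i Ri <-; rewrite good // => h; congr is_hdim: h; lia.
  have BA : hyper_le B A.
    by apply: (@tight_hyper_le _ A G (vertices H)) => //; rewrite eH.
  exists A, B; split=> //; split=> // e Be.
  have [Ae eP] := Be; have := repB.2 e (BV e Be).
  have [i Ri ei] := Ae; rewrite subHG.2 // -ei good // => h.
  by congr is_hdim: h; lia.
split; first by split=> [/i12|/i23/i31].
by split=> [/i12/i23|/i31].
Qed.
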